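(* Fix $0<p<1$ and $\kappa\in\mathbb{C}$, and let $\mathcal{R}(x;\underline{\phi}):V\otimes V\rightarrow V\otimes V$ be the linear operator defined in the context, depending meromorphically on $x\in\mathbb{C}$ and $\underline{\phi}\in\mathbb{C}^3$. Then $\mathcal{R}(x;\underline{\phi})$ satisfies the dynamical quantum Yang-Baxter equation in braid-like form $$\mathcal{R}_{12}(x;\underline{\phi}+\kappa h_3)\,\mathcal{R}_{23}(x+y;\underline{\phi}-\kappa h_1)\,\mathcal{R}_{12}(y;\underline{\phi}+\kappa h_3)=\mathcal{R}_{23}(y;\underline{\phi}-\kappa h_1)\,\mathcal{R}_{12}(x+y;\underline{\phi}+\kappa h_3)\,\mathcal{R}_{23}(x;\underline{\phi}-\kappa h_1)$$ as linear operators on $V\otimes V\otimes V$ (as an identity of meromorphic functions of $x,y\in\mathbb{C}$ and $\underline{\phi}\in\mathbb{C}^3$), and the unitarity relation $$\mathcal{R}(x;\underline{\phi})\,\mathcal{R}(-x;\underline{\phi})=\mathrm{Id}_{V^{\otimes 2}}.$$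
   Context: Let $V=\mathbb{C}v_1\oplus\mathbb{C}v_2\oplus\mathbb{C}v_3$ be a three-dimensional complex vector space with basis $v_1,v_2,v_3$, with parity $p(1)=p(2)=\overline{0}$, $p(3)=\overline{1}$ in $\mathbb{Z}/2\mathbb{Z}$ (the parity map $p(\cdot)$ is not to be confused with the number $p$). For a complex number $a$, $p^a:=e^{a\log p}$ with $\log p\in\mathbb{R}$. Put $$\theta(z;p):=\prod_{m=0}^{\infty}(1-p^mz)(1-p^{m+1}/z),\qquad \theta(z_1,\ldots,z_r;p):=\prod_{j=1}^r\theta(z_j;p),$$ and define, for $u,x\in\mathbb{C}$, $$A^u(x):=\frac{\theta(p^{2\kappa},p^{u-x};p)}{\theta(p^u,p^{2\kappa-x};p)}\,p^{(2\kappa-u)x},\qquad B^u(x):=\frac{\theta(p^{2\kappa-u},p^{-x};p)}{\theta(p^{2\kappa-x},p^{-u};p)}\,p^{2\kappa(x-u)},\qquad c(x):=p^{2\kappa x}\frac{\theta(p^{2\kappa+x};p)}{\theta(p^x;p)}.$$ For $\underline{\phi}=(\phi_1,\phi_2,\phi_3)\in\mathbb{C}^3$, $\mathcal{R}(x;\underline{\phi}):V\otimes V\to V\otimes V$ is the linear operator with $$\mathcal{R}(x;\underline{\phi})\,v_i\otimes v_i=(-1)^{p(i)}\frac{c(x)}{c((-1)^{p(i)}x)}\,v_i\otimes v_i\qquad(1\le i\le 3),$$ $$\mathcal{R}(x;\underline{\phi})\,v_i\otimes v_j=A^{\phi_i-\phi_j}(x)\,v_i\otimes v_j+(-1)^{p(i)+p(j)}B^{\phi_i-\phi_j}(x)\,v_j\otimes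 v_i\qquad(1\le i\neq j\le 3).$$ (Ordinary, non-graded, tensor products of operators are used.) Tensor leg notation: $\mathcal{R}_{12}=\mathcal{R}\otimes\mathrm{Id}_V$, $\mathcal{R}_{23}=\mathrm{Id}_V\otimes\mathcal{R}$. Dynamical shifts: the vectors $v_1,v_2,v_3$ have weights $\lambda^{(1)}=(1,0,0)$, $\lambda^{(2)}=(0,1,0)$, $\lambda^{(3)}=(0,0,-1)$ in $\mathbb{C}^3$ (this is the vector representation of $\mathfrak{gl}(2|1)$). For a family $G(\underline{\phi})$ of linear operators on $V^{\otimes 3}$ and $\beta\in\mathbb{C}$, $G(\underline{\phi}+\beta h_i)$ is the linear operator on $V^{\otimes 3}$ which acts on the subspace $V^{\otimes(i-1)}\otimes\mathbb{C}v_j\otimes V^{\otimes(3-i)}$ as $G(\underline{\phi}+\beta\lambda^{(j)})$, for $j=1,2,3$. *)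

(* Defs.v *)
From HB Require Import structures.
From mathcomp Require Import all_boot all_order all_algebra.
From mathcomp Require Export complex mxtens.
From mathcomp Require Import all_classical all_reals all_analysis.
Import numFieldNormedType.Exports.

Set Implicit Arguments.
Unset Strict Implicit.
Unset Printing Implicit Defensive.

Import Order.TTheory GRing.Theory Num.Theory.
Local Open Scope ring_scope.
Local Open Scope complex_scope.

Section Scalars.
Variables (R : realType) (p : R).
Implicit Types (z a u x kappa : R[i]).

Definition cexp z : R[i] :=
  (expR (complex.Re z))%:C * (cos (complex.Im z) +i* sin (complex.Im z)).

(* Only meant for 0 < p, where ln p is the real logarithm. *)
Definition cpow a : R[i] := cexp (a * (ln p)%:C).

(* R[i]^o is R[i] with the topology of the norm on the numFieldType R[i]. *)
Definition theta z : R[i] :=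
  limn (fun n : nat => \prod_(0 <= m < n)
    ((1 - p%:C ^+ m * z) * (1 - p%:C ^+ m.+1 / z)) : R[i]^o).

Definition coefA kappa u x : R[i] :=
  (theta (cpow (2 * kappa)) * theta (cpow (u - x)))
  / (theta (cpow u) * theta (cpow (2 * kappa - x)))
  * cpow ((2 * kappa - u) * x).

Definition coefB kappa u x : R[i] :=
  (theta (cpow (2 * kappa - u)) * theta (cpow (- x)))
  / (theta (cpow (2 * kappa - x)) * theta (cpow (- u)))
  * cpow (2 * kappa * (x - u)).

Definition coefc kappa x : R[i] :=
  cpow (2 * kappa * x) * (theta (cpow (2 * kappa + x)) / theta (cpow x)).

End Scalars.

(* The indices 1, 2, 3 are the elements 0, 1, 2 of 'I_3. *)
Definition parity (i : 'I_3) : nat := i == ord_max.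

Section Operators.
Variables (R : realType) (p : R) (kappa : R[i]).
Implicit Types (x beta : R[i]) (phi : 'rV[R[i]]_3).

(* Operators act on column vectors from the left; the basis vector
   v_i (x) v_j (x) v_k is vbasis i *t vbasis j *t vbasis k. *)
Definition vbasis (i : 'I_3) : 'cV[R[i]]_3 := delta_mx i 0.

Definition Rimage x phi (i j : 'I_3) : 'cV[R[i]]_(3 * 3) :=
  if i == j then
    ((-1) ^+ parity i * (coefc p kappa x / coefc p kappa ((-1) ^+ parity i * x)))
      *: (vbasis i *t vbasis i)
  else
    coefA p kappa (phi 0 i - phi 0 j) x *: (vbasis i *t vbasis j)
    + ((-1) ^+ (parity i + parity j) * coefB p kappa (phi 0 i - phi 0 j) x)
      *: (vbasis j *t vbasis i).

Definition Rop x phi : 'M[R[i]]_(3 * 3) :=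
  \matrix_(a, b) Rimage x phi (mxtens_unindex b).1 (mxtens_unindex b).2 a 0.

Definition op12 (M : 'M[R[i]]_(3 * 3)) : 'M[R[i]]_(3 * 3 * 3) := M *t 1%:M.

Definition op23 (M : 'M[R[i]]_(3 * 3)) : 'M[R[i]]_(3 * 3 * 3) :=
  castmx (mulnA 3 3 3, mulnA 3 3 3) (1%:M *t M).

Definition weight (j : 'I_3) : 'rV[R[i]]_3 := (-1) ^+ parity j *: delta_mx 0 j.

Definition leg_proj (l j : 'I_3) : 'M[R[i]]_(3 * 3 * 3) :=
  let E m : 'M[R[i]]_3 := if m == l then delta_mx j j else 1%:M in
  E 0 *t E 1 *t E ord_max.

(* G (phi + beta h_l); see dyn_shiftE below. *)
Definition dyn_shift (G : 'rV[R[i]]_3 -> 'M[R[i]]_(3 * 3 * 3))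
    beta (l : 'I_3) phi : 'M[R[i]]_(3 * 3 * 3) :=
  \sum_(j < 3) G (phi + beta *: weight j) *m leg_proj l j.

(* The denominators in the formulas for the entries of Rop x phi do not
   vanish. This is a dense open condition on (x, phi); an identity of
   meromorphic functions is an identity of values off the zeros of the
   denominators. The clause on coefc excludes the zeros of coefc x, where the
   quotient coefc x / coefc x is 0 in R[i] and not 1. *)
Definition regular x phi : Prop :=
  [/\ theta p (cpow p x) != 0 /\ theta p (cpow p (- x)) != 0,
      forall i : 'I_3, coefc p kappa ((-1) ^+ parity i * x) != 0,
      theta p (cpow p (2 * kappa - x)) != 0 &
      forall i j : 'I_3, i != j -> theta p (cpow p (phi 0 i - phi 0 j)) != 0].

Lemma col_tens_basis m n q (M : 'M[R[i]]_(q, m * n)) (i : 'I_m) (j : 'I_n) :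
  M *m ((delta_mx i 0 : 'cV_m) *t (delta_mx j 0 : 'cV_n)) =
  col (mxtens_index (i, j)) M.
Proof.
suff -> : (delta_mx i 0 : 'cV[R[i]]_m) *t (delta_mx j 0 : 'cV_n) =
          (delta_mx (mxtens_index (i, j)) 0 : 'cV_(m * n)) by rewrite colE.
apply/matrixP => a b; case: (mxtens_indexP a) => k l.
rewrite !mxE !mxtens_indexK /= (can_eq (@mxtens_indexK m n)) xpair_eqE.
by rewrite [b]ord1 !andbT -natrM mulnb.
Qed.

Lemma RopE x phi i j : Rop x phi *m (vbasis i *t vbasis j) = Rimage x phi i j.
Proof.
rewrite col_tens_basis; apply/matrixP => a b.
by rewrite !mxE mxtens_indexK [b]ord1.
Qed.

Lemma op12E M i j k :
  op12 M *m (vbasis i *t vbasis j *t vbasis k) =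
  (M *m (vbasis i *t vbasis j)) *t vbasis k.
Proof. by rewrite tensmx_mul mul1mx. Qed.

(* The products of sizes are associative up to conversion, but the indices
   of the two sides are not convertible as ordinals, hence the casts. *)
Lemma tensmxA m n q m' n' q' (A : 'M[R[i]]_(m, m')) (B : 'M[R[i]]_(n, n'))
    (D : 'M[R[i]]_(q, q')) :
  castmx (mulnA m n q, mulnA m' n' q') (A *t (B *t D)) = A *t B *t D.
Proof.
apply/matrixP => a b.
case: (mxtens_indexP a) => ij k; case: (mxtens_indexP ij) => i j.
case: (mxtens_indexP b) => ij' k'; case: (mxtens_indexP ij') => i' j'.
have idxA (u v w : nat) (r : 'I_u) (s : 'I_v) (t : 'I_w) :
    cast_ord (esym (mulnA u v w)) (mxtens_index (mxtens_index (r, s), t)) =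
    mxtens_index (r, mxtens_index (s, t)).
  by apply: val_inj; rewrite /= mulnDl -mulnA addnA.
by rewrite castmxE !idxA !tensmxE mulrA.
Qed.

Lemma op23E M i j k :
  op23 M *m (vbasis i *t vbasis j *t vbasis k) =
  castmx (mulnA 3 3 3, mulnA 1 1 1)
    (vbasis i *t (M *m (vbasis j *t vbasis k))).
Proof.
rewrite -tensmxA /op23.
have castM (a b c d : nat) (ab : a = b) (cd : c = d) (X : 'M[R[i]]_a)
    (Y : 'M[R[i]]_(a, c)) : castmx (ab, ab) X *m castmx (ab, cd) Y =
      castmx (ab, cd) (X *m Y).
  by move: Y; case: _ / cd; move: X; case: _ / ab => X Y; rewrite !castmx_id.
by rewrite castM tensmx_mul mul1mx.
Qed.

Lemma leg_projE l m i j k :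
  leg_proj l m *m (vbasis i *t vbasis j *t vbasis k) =
  (m == nth i [:: i; j; k] l)%:R *: (vbasis i *t vbasis j *t vbasis k).
Proof.
have deltaE (r : 'I_3) : delta_mx m m *m vbasis r = (m == r)%:R *: vbasis r.
  case: eqVneq => [->|neq]; first by rewrite mul_delta_mx scale1r.
  by rewrite mul_delta_mx_0 ?scale0r.
rewrite /leg_proj !tensmx_mul.
have scale_tl c a b d e (A : 'M[R[i]]_(a, b)) (B : 'M[R[i]]_(d, e)) :
    (c *: A) *t B = c *: (A *t B).
  by apply/matrixP => s t; rewrite !mxE mulrA.
have scale_tr c a b d e (A : 'M[R[i]]_(a, b)) (B : 'M[R[i]]_(d, e)) :
    A *t (c *: B) = c *: (A *t B).
  by apply/matrixP => s t; rewrite !mxE mulrCA.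
by case: l => [[|[|[|]]] //= ?]; rewrite !mul1mx deltaE ?(scale_tl, scale_tr).
Qed.

Lemma dyn_shiftE G beta l phi i j k :
  dyn_shift G beta l phi *m (vbasis i *t vbasis j *t vbasis k) =
  G (phi + beta *: weight (nth i [:: i; j; k] l))
    *m (vbasis i *t vbasis j *t vbasis k).
Proof.
rewrite mulmx_suml (bigD1 (nth i [:: i; j; k] l)) //= big1 => [|m neq_m].
  by rewrite -mulmxA leg_projE eqxx scale1r addr0.
by rewrite -mulmxA leg_projE (negPf neq_m) scale0r mulmx0.
Qed.

End Operators.

(* Main.v *)
Require Import Defs.
From mathcomp Require Import all_boot all_order all_algebra.
From mathcomp Require Import all_classical all_reals all_analysis.
From mathcomp Require Import ring lra zify.
Import numFieldNormedType.Exports.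

(* Put s(u) = p^(u(u-1)/2) theta(p^u) and eta = 2 kappa. Then s is odd, the
   exponential prefactors of A, B and c are absorbed by s, and
     A^u(x) = s(eta) s(u-x) / (s(u) s(eta-x)),
     B^u(x) = s(eta-u) s(x) / (s(u) s(eta-x)),
   while the diagonal entries are 1 and s(eta+x) / s(eta-x). On each orbit of
   words v_i v_j v_k the braid and unitarity relations become identities that
   follow from the three-term relation
     K(x,y) K(z,w) - K(x,z) K(y,w) + K(x,w) K(y,z) = 0,
     K(x,z) = s(x+z) s(x-z).
   This is the vanishing of a Pfaffian, and it holds because K is antisymmetric
   and of rank 2. The rank comes from the Jacobi triple product: theta is a
   constant multiple of sum_k (-1)^k p^(k(k-1)/2) z^k, and in the double sum for
   theta(xz) theta(x/z) the substitution (m, l) = (a+b, a-b) or (a+b+1, a-b)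
   separates x from z. *)

Set Implicit Arguments.
Unset Strict Implicit.
Unset Printing Implicit Defensive.

Import Order.TTheory GRing.Theory Num.Theory.
Local Open Scope ring_scope.
Local Open Scope complex_scope.

(** * Scalar identities from the three-term relation *)

(* Reduces the goal [e = 0] to the ring identity between e and the combination of
   the equations H1, H2, H3 with coefficients c1, c2, c3. *)
Ltac combine3 H1 c1 H2 c2 H3 c3 :=
  match type of H1 with ?L1 = ?R1 => match type of H2 with ?L2 = ?R2 =>
  match type of H3 with ?L3 = ?R3 =>
    transitivity ((L1 - R1) * c1 + (L2 - R2) * c2 + (L3 - R3) * c3);
    last by rewrite H1 H2 H3 !subrr !mul0r !addr0
  end end end.

(** Rearranging the double theta series directly would need summability over pairs of integers.
    Instead the separation of x and z is kept exact at every finite stage, by summing over regions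
    of the lattice adapted to (a, b), and only the vanishing 3 by 3 minors pass to the limit. Minors
    rather than the Pfaffian itself come out of the rank; each suitable minor is an entry times the
    Pfaffian, so the zeros of K need an argument of their own. The triple product is taken from its
    finite form, whose q-binomial coefficients have a limit independent of k; one domination
    argument then suffices, and the value of the constant never enters. The odd letter brings no new
    identity: its weight and its diagonal entry put - eta for eta in the same instances of the
    three-term relation. *)

Section DynamicalWeights.
Variables (F : fieldType) (s : F -> F).
Hypothesis sN : forall x, s (- x) = - s x.
(* The Pfaffian relation at (x, y, z, w) with a = x+y, b = x-y, c = x+z, d = x+w,
   which avoids halves. *)
Hypothesis three_term : forall a b c d,
  s a * s b * s (c + d - a - b) * s (c - d)
  - s c * s (a + b - c) * s (d - b) * s (a - d)
  + s d * s (a + b - d) * s (c - b) * s (a - c) = 0.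

Lemma three_term_eq a b c d e f g h i j k l :
  e = c + d - a - b -> f = c - d -> g = a + b - c -> h = d - b ->
  i = a - d -> j = a + b - d -> k = c - b -> l = a - c ->
  s a * s b * s e * s f - s c * s g * s h * s i + s d * s j * s k * s l = 0.
Proof. by move=> -> -> -> -> -> -> -> ->. Qed.

Lemma sB a b : s (a - b) = - s (b - a).
Proof. by rewrite -sN opprB. Qed.

(** The Pfaffian at (e, u, v, 0), where K(u, 0) = s(u)^2. At e = eta it becomes unitarity. *)
Lemma three_term_sqr e u v :
  s (e + u) * s (e - u) * s v * s v - s (e + v) * s (e - v) * s u * s u
  + s e * s e * s (u + v) * s (u - v) = 0.
Proof.
rewrite -(@three_term_eq (e + u) (e - u) (e + v) e v v (e - v) u u e (u + v)
  (u - v)) //; ring.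
Qed.

Lemma three_term_jik u v x y :
  s (u + v) * s x * s (v - (x + y)) * s (u - y)
  - s (u + v - y) * s (x + y) * s (v - x) * s u
  + s v * s (u + x) * s (u + v - (x + y)) * s y = 0.
Proof. by apply: three_term_eq; ring. Qed.

Lemma three_term_ijk u v x y :
  s (u - x) * s (u - y) * s (v - (x + y)) * s v
  - s (v - x) * s (v - y) * s (u - (x + y)) * s u
  + s x * s y * s (u + v - (x + y)) * s (u - v) = 0.
Proof.
have := @three_term_eq u (u - (x + y)) (u - x) (u + v - (x + y)) (v - x)
  (y - v) (u - y) v (x + y - v) (u - v) y x.
rewrite (sB y) (sB _ v) => I; rewrite -I; ring.
Qed.

Variable eta : F.

Definition dynA u x := s eta * s (u - x) / (s u * s (eta - x)).
Definition dynB u x := s (eta - u) * s x / (s u * s (eta - x)).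
Definition dynD (b : bool) x := s (eta - (-1) ^+ b * x) / s (eta - x).

(** [dynB u x] is a function of [u] times a function of [x]. This settles the target words that each
    side of the braid relation reaches by a single path with two swaps. *)
Lemma dynB_swap u v x y : dynB u x * dynB v y = dynB u y * dynB v x.
Proof. by rewrite /dynB !invfM; ring. Qed.

Lemma dyn_unitarity_diag u x : s u != 0 -> s (eta - x) != 0 ->
  s (eta + x) != 0 ->
  dynA u x * dynA u (- x) + dynB (- u) x * dynB u (- x) = 1.
Proof.
move=> u0 x0 x1; apply: subr0_eq; rewrite /dynA /dynB !opprK !sN.
transitivity ((s (eta + u) * s (eta - u) * s x * s x
  - s (eta + x) * s (eta - x) * s u * s u
  + s eta * s eta * s (u + x) * s (u - x)) /
  (s u * s u * s (eta - x) * s (eta + x))).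
  by field; rewrite ?oppr_eq0 ?u0 ?x0 ?x1.
by rewrite three_term_sqr mul0r.
Qed.

Lemma dyn_unitarity_off u x : s u != 0 -> s (eta - x) != 0 ->
  s (eta + x) != 0 ->
  dynB u x * dynA u (- x) + dynA (- u) x * dynB u (- x) = 0.
Proof.
move=> u0 x0 x1; rewrite /dynA /dynB !opprK -opprD !sN.
by field; rewrite ?oppr_eq0 ?u0 ?x0 ?x1.
Qed.

Lemma dyn_unitarity n u x sg (v v' : 'cV[F]_n) :
  s u != 0 -> s (eta - x) != 0 -> s (eta + x) != 0 -> sg = 1 \/ sg = - 1 ->
  dynA u (- x) *: (dynA u x *: v + (sg * dynB u x) *: v')
  + (sg * dynB u (- x)) *: (dynA (- u) x *: v' + (sg * dynB (- u) x) *: v) = v.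
Proof.
move=> u0 x0 x1 sgP; have H1 := dyn_unitarity_diag u0 x0 x1.
have H2 := dyn_unitarity_off u0 x0 x1.
rewrite -[RHS]scale1r -H1; apply/matrixP => i j; rewrite !mxE; apply: subr0_eq.
transitivity ((dynB u x * dynA u (- x) + dynA (- u) x * dynB u (- x)) * (sg * v' i j)).
  by case: sgP => ->; ring.
by rewrite H2 mul0r.
Qed.

Section Spectral.
Variables (x y : F).
Hypotheses (x0 : s (eta - x) != 0) (y0 : s (eta - y) != 0).
Hypothesis xy0 : s (eta - (x + y)) != 0.

(** In these names the first word is the source and the second the target, with u = phi_i - phi_j
    and v = phi_j - phi_k. Each summand is a path whose factors are listed in the order in which the
    operators act. *)
Lemma dyn_ijk_jik u v : s u != 0 -> s v != 0 -> s (u + v) != 0 ->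
  dynA u y * dynA v (x + y) * dynB u x
  + dynB u y * dynA (u + v) (x + y) * dynA (- u) x
  = dynA v x * dynB u (x + y) * dynA (u + v) y.
Proof.
move=> u0 v0 uv0; apply: subr0_eq; rewrite /dynA /dynB -opprD !sN.
transitivity ((s (u + v) * s x * s (v - (x + y)) * s (u - y)
  - s (u + v - y) * s (x + y) * s (v - x) * s u
  + s v * s (u + x) * s (u + v - (x + y)) * s y) * s eta * s eta * s (eta - u) /
  (s u * s u * s v * s (u + v) * s (eta - x) * s (eta - y) * s (eta - (x + y)))).
  by field; rewrite ?oppr_eq0 ?u0 ?v0 ?uv0 ?x0 ?y0 ?xy0.
by rewrite three_term_jik !mul0r.
Qed.

Lemma dyn_ijk_ikj u v : s u != 0 -> s v != 0 -> s (u + v) != 0 ->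
  dynA u y * dynB v (x + y) * dynA (u + v) x
  = dynA v x * dynA u (x + y) * dynB v y
    + dynB v x * dynA (u + v) (x + y) * dynA (- v) y.
Proof.
move=> u0 v0 uv0; apply/esym/subr0_eq; rewrite /dynA /dynB -opprD !sN.
transitivity ((s (v + u) * s y * s (u - (y + x)) * s (v - x)
  - s (v + u - x) * s (y + x) * s (u - y) * s v
  + s u * s (v + y) * s (v + u - (y + x)) * s x) * s eta * s eta * s (eta - v) /
  (s v * s u * s v * s (u + v) * s (eta - x) * s (eta - y) * s (eta - (x + y)))).
  rewrite (addrC v u) (addrC y x).
  by field; rewrite ?oppr_eq0 ?u0 ?v0 ?uv0 ?x0 ?y0 ?xy0.
by rewrite three_term_jik !mul0r.
Qed.

Lemma dyn_ijk_ijk u v : s u != 0 -> s v != 0 -> s (u + v) != 0 ->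
  dynA u y * dynA v (x + y) * dynA u x
  + dynB u y * dynA (u + v) (x + y) * dynB (- u) x
  = dynA v x * dynA u (x + y) * dynA v y
    + dynB v x * dynA (u + v) (x + y) * dynB (- v) y.
Proof.
move=> u0 v0 uv0; apply: subr0_eq; rewrite /dynA /dynB !opprK !sN.
(* Both instances contain the term with s(u + v) s(u - v). It cancels in the difference, and what
   remains is the numerator. *)
transitivity (((s (u - x) * s (u - y) * s (v - (x + y)) * s v
    - s (v - x) * s (v - y) * s (u - (x + y)) * s u
    + s x * s y * s (u + v - (x + y)) * s (u - v)) * s eta * s eta * s (u + v)
  - (s (eta + u) * s (eta - u) * s v * s v - s (eta + v) * s (eta - v) * s u * s u
    + s eta * s eta * s (u + v) * s (u - v)) * s x * s y * s (u + v - (x + y)))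
  * s eta / (s u * s u * s v * s v * s (u + v) * s (eta - x) * s (eta - y)
    * s (eta - (x + y)))).
  by field; rewrite ?oppr_eq0 ?u0 ?v0 ?uv0 ?x0 ?y0 ?xy0.
by rewrite three_term_ijk three_term_sqr !mul0r subrr !mul0r.
Qed.

Variable b : bool.

(* For the word v_i v_i v_j, b is the parity of i, and w and w' are the values of
   phi_i - phi_j after the shifts by - kappa h_1 and + kappa h_3 where leg 1,
   resp. leg 3, carries v_i. *)
Let zeta := (-1) ^+ b * eta.

Lemma dyn_iij_iij w w' : w' = w + zeta -> s w != 0 -> s w' != 0 ->
  dynD b y * dynA w (x + y) * dynD b x
  = dynA w x * dynD b (x + y) * dynA w y
    + dynB w x * dynA w' (x + y) * dynB (- w) y.
Proof.
move=> w'E w0 w'0; apply: subr0_eq; rewrite /dynA /dynB /dynD !opprK !sN.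
(* The repeated letter puts zeta in place of phi_i - phi_j: s(zeta - x) is s(eta - x) for an even
   letter and - s(eta + x) for an odd one, matching the numerator of [dynD]. *)
have := three_term_ijk zeta w x y; rewrite (addrC zeta w) -w'E /zeta.
rewrite /zeta in w'E; case: b w'E => /= w'E;
  rewrite ?expr1 ?expr0 ?mul1r ?mulN1r ?opprK.
  have -> : s (eta - w) = - s w' by rewrite w'E -sN; congr s; ring.
  rewrite -!opprD !sN => I.
  match type of I with ?J = _ => transitivity (J * s eta / (s w * s w *
    s (eta - x) * s (eta - y) * s (eta - (x + y)))) end.
    by field; rewrite ?oppr_eq0 ?w0 ?w'0 ?x0 ?y0 ?xy0.
  by rewrite I !mul0r.
have -> : s (eta + w) = s w' by rewrite w'E; congr s; ring.
move=> I.
match type of I with ?J = _ => transitivity (J * s eta / (s w * s w *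
    s (eta - x) * s (eta - y) * s (eta - (x + y)))) end.
  by field; rewrite ?oppr_eq0 ?w0 ?w'0 ?x0 ?y0 ?xy0.
by rewrite I !mul0r.
Qed.

Lemma dyn_iij_iji w w' : w' = w + zeta -> s w != 0 -> s w' != 0 ->
  dynD b y * dynB w (x + y) * dynA w' x
  = dynA w x * dynD b (x + y) * dynB w y
    + dynB w x * dynA w' (x + y) * dynA (- w) y.
Proof.
move=> w'E w0 w'0; apply: subr0_eq; rewrite /dynA /dynB /dynD -opprD !sN.
have := three_term_jik w zeta y x.
rewrite -w'E (addrC y x) /zeta.
rewrite /zeta in w'E; case: b w'E => /= w'E;
  rewrite ?expr1 ?expr0 ?mul1r ?mulN1r ?opprK.
  rewrite -!opprD !sN => I.
  match type of I with ?J = _ => transitivity (J * s eta * s (eta - w) /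
    (s w * s w * s w' * s (eta - x) * s (eta - y) * s (eta - (x + y)))) end.
    by field; rewrite ?oppr_eq0 ?w0 ?w'0 ?x0 ?y0 ?xy0.
  by rewrite I !mul0r.
move=> I.
match type of I with ?J = _ => transitivity (- J * s eta * s (eta - w) /
    (s w * s w * s w' * s (eta - x) * s (eta - y) * s (eta - (x + y)))) end.
  by field; rewrite ?oppr_eq0 ?w0 ?w'0 ?x0 ?y0 ?xy0.
by rewrite I oppr0 !mul0r.
Qed.

Lemma dyn_iji_iji w w' : w' = w + zeta -> s w != 0 -> s w' != 0 ->
  dynA w' y * dynA (- w) (x + y) * dynA w' x
    + dynB w' y * dynD b (x + y) * dynB (- w') x
  = dynA (- w) x * dynA w' (x + y) * dynA (- w) y
    + dynB (- w) x * dynD b (x + y) * dynB w y.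
Proof.
move=> w'E w0 w'0; apply: subr0_eq; rewrite /dynA /dynB /dynD -!opprD !opprK !sN.
(* The last terms of both instances contain s(w + w'). Since w' - w = zeta, the second one carries
   s(eta)^3 up to sign, so weighting the first by s(eta)^3 eliminates them. *)
have I1 := three_term_ijk w' (- w) x y.
have I2 := three_term_sqr zeta w w'.
move: I1 I2; rewrite -!opprD !sN !opprK.
have -> : w' - w = zeta by rewrite w'E; ring.
have -> : zeta + w = w' by rewrite w'E; ring.
have -> : zeta - w' = - w by rewrite w'E; ring.
have -> : w - w' = - zeta by rewrite w'E; ring.
rewrite (addrC w' w) /zeta.
rewrite /zeta in w'E; case: b w'E => /= w'E;
  rewrite ?expr1 ?expr0 ?mul1r ?mulN1r ?opprK;
  rewrite -?opprD ?sN ?opprK.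
  have -> : s (eta - w) = - s w' by rewrite w'E -sN; congr s; ring.
  have -> : s (eta + w') = s w by rewrite w'E; congr s; ring.
  have -> : s (- eta + w') = - s (eta - w') by rewrite -sN; congr s; ring.
  move=> I1 I2.
  match type of I1 with ?J1 = _ => match type of I2 with ?J2 = _ =>
    transitivity ((J1 * s eta * s eta * s eta + J2 * s x * s y * s (eta + (x + y))) /
    (s w * s w * s w' * s w' * s (eta - x) * s (eta - y) * s (eta - (x + y)))) end end.
    by field; rewrite ?oppr_eq0 ?w0 ?w'0 ?x0 ?y0 ?xy0.
  by rewrite I1 I2 !mul0r addr0 !mul0r.
have -> : s (eta + w) = s w' by rewrite w'E; congr s; ring.
have -> : s (eta - w') = - s w by rewrite w'E -sN; congr s; ring.
move=> I1 I2.
match type of I1 with ?J1 = _ => match type of I2 with ?J2 = _ =>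
    transitivity ((J1 * s eta * s eta * s eta + J2 * s x * s y * s (eta - (x + y))) /
    (s w * s w * s w' * s w' * s (eta - x) * s (eta - y) * s (eta - (x + y)))) end end.
  by field; rewrite ?oppr_eq0 ?w0 ?w'0 ?x0 ?y0 ?xy0.
by rewrite I1 I2 !mul0r addr0 !mul0r.
Qed.

Lemma dyn_iji_iij w w' : w' = w + zeta -> s w != 0 -> s w' != 0 ->
  dynA w' y * dynB (- w) (x + y) * dynD b x
  = dynA (- w) x * dynA w' (x + y) * dynB (- w) y
    + dynB (- w) x * dynD b (x + y) * dynA w y.
Proof.
move=> w'E w0 w'0; apply: subr0_eq; rewrite /dynA /dynB /dynD -opprD !sN.
have := three_term_jik w zeta x y.
rewrite -w'E /zeta.
rewrite /zeta in w'E; case: b w'E => /= w'E;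
  rewrite ?expr1 ?expr0 ?mul1r ?mulN1r ?opprK.
  rewrite -!opprD !sN => I.
  match type of I with ?J = _ => transitivity (- J * s eta * s (eta + w) /
    (s w * s w * s w' * s (eta - x) * s (eta - y) * s (eta - (x + y)))) end.
    by field; rewrite ?oppr_eq0 ?w0 ?w'0 ?x0 ?y0 ?xy0.
  by rewrite I oppr0 !mul0r.
move=> I.
match type of I with ?J = _ => transitivity (J * s eta * s (eta + w) /
    (s w * s w * s w' * s (eta - x) * s (eta - y) * s (eta - (x + y)))) end.
  by field; rewrite ?oppr_eq0 ?w0 ?w'0 ?x0 ?y0 ?xy0.
by rewrite I !mul0r.
Qed.

End Spectral.

(* The reflection (w, w', x, y) |-> (- w', - w, y, x) preserves w' = w + zeta and
   exchanges the relations for iij with those for jii. *)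
Section Mirror.
Variables (x y : F) (b : bool) (w w' : F).
Hypotheses (x0 : s (eta - x) != 0) (y0 : s (eta - y) != 0).
Hypothesis xy0 : s (eta - (x + y)) != 0.
Hypothesis w'E : w' = w + (-1) ^+ b * eta.
Hypotheses (w0 : s w != 0) (w'0 : s w' != 0).

Let yx0 : s (eta - (y + x)) != 0. Proof. by rewrite (addrC y). Qed.
Let NwE : - w = - w' + (-1) ^+ b * eta. Proof. rewrite w'E; ring. Qed.
Let Nw0 : s (- w) != 0. Proof. by rewrite sN oppr_eq0. Qed.
Let Nw'0 : s (- w') != 0. Proof. by rewrite sN oppr_eq0. Qed.

Lemma dyn_jii_jii :
  dynA (- w') y * dynD b (x + y) * dynA (- w') x
  + dynB (- w') y * dynA (- w) (x + y) * dynB w' x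
  = dynD b x * dynA (- w') (x + y) * dynD b y.
Proof.
by have := dyn_iij_iij y0 x0 yx0 NwE Nw'0 Nw0; rewrite opprK (addrC y x) => ->.
Qed.

Lemma dyn_jii_iji :
  dynA (- w') y * dynD b (x + y) * dynB (- w') x
  + dynB (- w') y * dynA (- w) (x + y) * dynA w' x
  = dynD b x * dynB (- w') (x + y) * dynA (- w) y.
Proof.
by have := dyn_iij_iji y0 x0 yx0 NwE Nw'0 Nw0; rewrite opprK (addrC y x) => ->.
Qed.

Lemma dyn_iji_jii :
  dynA w' y * dynA (- w) (x + y) * dynB w' x
  + dynB w' y * dynD b (x + y) * dynA (- w') x
  = dynA (- w) x * dynB w' (x + y) * dynD b y.
Proof.
by have := dyn_iji_iij y0 x0 yx0 NwE Nw'0 Nw0; rewrite opprK (addrC y x) => ->.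
Qed.

End Mirror.

(** * The braid relation on each orbit of words *)

Section BraidBlocks.
Variables (n : nat) (X12 X23 : F -> 'M[F]_n).

Definition braid_at x y (v : 'cV[F]_n) :=
  X12 x *m (X23 (x + y) *m (X12 y *m v)) = X23 y *m (X12 (x + y) *m (X23 x *m v)).

Lemma braid_atE x y v : braid_at x y v ->
  X12 x *m X23 (x + y) *m X12 y *m v = X23 y *m X12 (x + y) *m X23 x *m v.
Proof. by rewrite -!mulmxA. Qed.

Lemma braid_equal x y (d : F -> F) (v : 'cV[F]_n) :
  (forall z, z \in [:: x; y; x + y] -> X12 z *m v = d z *: v) ->
  (forall z, z \in [:: x; y; x + y] -> X23 z *m v = d z *: v) ->
  braid_at x y v.
Proof.
move=> E12 E23; have xin : x \in [:: x; y; x + y] by rewrite !inE eqxx.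
have yin : y \in [:: x; y; x + y] by rewrite !inE eqxx orbT.
have xyin : x + y \in [:: x; y; x + y] by rewrite !inE eqxx !orbT.
have E := (E12 x xin, E12 y yin, E12 _ xyin, E23 x xin, E23 y yin, E23 _ xyin).
rewrite /braid_at !(E, =^~ scalemxAr, scalerA); congr (_ *: _); ring.
Qed.

Section TwoEqual.
Variables (x y w w' sg : F) (b : bool) (iij iji jii : 'cV[F]_n).
Hypotheses (x0 : s (eta - x) != 0) (y0 : s (eta - y) != 0).
Hypothesis xy0 : s (eta - (x + y)) != 0.
Hypothesis w'E : w' = w + (-1) ^+ b * eta.
Hypotheses (w0 : s w != 0) (w'0 : s w' != 0).
Hypothesis sgP : sg = 1 \/ sg = - 1.
Hypothesis X12iij : forall z, z \in [:: x; y; x + y] -> X12 z *m iij = dynD b z *: iij.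
Hypothesis X23jii : forall z, z \in [:: x; y; x + y] -> X23 z *m jii = dynD b z *: jii.
Hypothesis X12iji : forall z,
  X12 z *m iji = dynA w' z *: iji + (sg * dynB w' z) *: jii.
Hypothesis X12jii : forall z,
  X12 z *m jii = dynA (- w') z *: jii + (sg * dynB (- w') z) *: iji.
Hypothesis X23iij : forall z,
  X23 z *m iij = dynA w z *: iij + (sg * dynB w z) *: iji.
Hypothesis X23iji : forall z,
  X23 z *m iji = dynA (- w) z *: iji + (sg * dynB (- w) z) *: iij.

(** The span of the three words is stable under both operators. That iij and jii are eigenvectors is
    assumed at the three spectral values only, since the diagonal entries are known to equal [dynD]
    only under regularity. *)
Lemma braid_two_equal :
  [/\ braid_at x y iij, braid_at x y iji & braid_at x y jii].
Proof.
have xin : x \in [:: x; y; x + y] by rewrite !inE eqxx.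
have yin : y \in [:: x; y; x + y] by rewrite !inE eqxx orbT.
have xyin : x + y \in [:: x; y; x + y] by rewrite !inE eqxx !orbT.
have E := (X12iij xin, X12iij yin, X12iij xyin, X23jii xin, X23jii yin,
  X23jii xyin, X12iji, X12jii, X23iij, X23iji, mulmxDr, =^~ scalemxAr).
rewrite /braid_at; split; rewrite !E; apply/matrixP => i j; rewrite !mxE;
  apply: subr0_eq; move: (iij i j) (iji i j) (jii i j) => E1 E2 E3.
- have H1 := dyn_iij_iij x0 y0 xy0 w'E w0 w'0.
  have H2 := dyn_iij_iji x0 y0 xy0 w'E w0 w'0.
  have H3 := dynB_swap w w' (x + y) x.
  combine3 H1 E1 H2 (sg * E2) H3 (dynD b y * E3).
  by case: sgP => ->; ring.
- have H1 := dyn_iji_iij x0 y0 xy0 w'E w0 w'0.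
  have H2 := dyn_iji_iji x0 y0 xy0 w'E w0 w'0.
  have H3 := dyn_iji_jii x0 y0 xy0 w'E w0 w'0.
  combine3 H1 (sg * E1) H2 E2 H3 (sg * E3).
  by case: sgP => ->; ring.
- have H1 := dynB_swap (- w') (- w) y (x + y).
  have H2 := dyn_jii_iji x0 y0 xy0 w'E w0 w'0.
  have H3 := dyn_jii_jii x0 y0 xy0 w'E w0 w'0.
  combine3 H1 (dynD b x * E1) H2 (sg * E2) H3 E3.
  by case: sgP => ->; ring.
Qed.

End TwoEqual.

Lemma braid_distinct x y u v sij sjk sik (ijk jik ikj jki kij kji : 'cV[F]_n) :
  s (eta - x) != 0 -> s (eta - y) != 0 -> s (eta - (x + y)) != 0 ->
  s u != 0 -> s v != 0 -> s (u + v) != 0 ->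
  sij = 1 \/ sij = - 1 -> sjk = 1 \/ sjk = - 1 ->
  (forall z, X12 z *m ijk = dynA u z *: ijk + (sij * dynB u z) *: jik) ->
  (forall z, X12 z *m jik = dynA (- u) z *: jik + (sij * dynB (- u) z) *: ijk) ->
  (forall z, X12 z *m ikj = dynA (u + v) z *: ikj + (sik * dynB (u + v) z) *: kij) ->
  (forall z, X12 z *m jki = dynA v z *: jki + (sjk * dynB v z) *: kji) ->
  (forall z, X23 z *m ijk = dynA v z *: ijk + (sjk * dynB v z) *: ikj) ->
  (forall z, X23 z *m ikj = dynA (- v) z *: ikj + (sjk * dynB (- v) z) *: ijk) ->
  (forall z, X23 z *m jik = dynA (u + v) z *: jik + (sik * dynB (u + v) z) *: jki) ->
  (forall z, X23 z *m kij = dynA u z *: kij + (sij * dynB u z) *: kji) ->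
  braid_at x y ijk.
Proof.
move=> x0 y0 xy0 u0 v0 uv0 sijP sjkP A1 A2 A3 A4 B1 B2 B3 B4.
rewrite /braid_at !(A1, A2, A3, A4, B1, B2, B3, B4, mulmxDr, =^~ scalemxAr).
apply/matrixP => i j; rewrite !mxE; apply: subr0_eq.
move: (ijk i j) (jik i j) (ikj i j) (jki i j) (kij i j) (kji i j).
move=> E1 E2 E3 E4 E5 E6.
have H1 := dyn_ijk_ijk x0 y0 xy0 u0 v0 uv0.
have H2 := dyn_ijk_jik x0 y0 xy0 u0 v0 uv0.
have H3 := dyn_ijk_ikj x0 y0 xy0 u0 v0 uv0.
have H4 := dynB_swap u (u + v) y (x + y).
have H5 := dynB_swap v (u + v) (x + y) x.
(* The targets jki and kij are settled by [dynB_swap] and packed into one null expression. The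
   target kji receives the same product on both sides. *)
have H4' : (dynB u y * dynB (u + v) (x + y) - dynB u (x + y) * dynB (u + v) y) *
  (sij * sik * dynA v x * E4) + (dynB v (x + y) * dynB (u + v) x -
  dynB v x * dynB (u + v) (x + y)) * (sjk * sik * dynA u y * E5) = 0.
  by rewrite H4 H5 !subrr !mul0r addr0.
rewrite -[LHS]subr0 -[X in _ - X]H4'.
combine3 H1 E1 H2 (sij * E2) H3 (sjk * E3).
by case: sijP => ->; case: sjkP => ->; ring.
Qed.

End BraidBlocks.
End DynamicalWeights.

(** * Operators on tensor powers *)

Lemma tensmxDl (K : comNzRingType) m n q r (M N : 'M[K]_(m, n)) (P : 'M[K]_(q, r)) :
  (M + N) *t P = M *t P + N *t P.
Proof. by apply/matrixP => i j; rewrite !mxE mulrDl. Qed.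

Lemma tensmxDr (K : comNzRingType) m n q r (M N : 'M[K]_(m, n)) (P : 'M[K]_(q, r)) :
  P *t (M + N) = P *t M + P *t N.
Proof. by apply/matrixP => i j; rewrite !mxE mulrDr. Qed.

Lemma tensmxZl (K : comNzRingType) m n q r a (M : 'M[K]_(m, n)) (P : 'M[K]_(q, r)) :
  (a *: M) *t P = a *: (M *t P).
Proof. by apply/matrixP => i j; rewrite !mxE mulrA. Qed.

Lemma tensmxZr (K : comNzRingType) m n q r a (M : 'M[K]_(m, n)) (P : 'M[K]_(q, r)) :
  P *t (a *: M) = a *: (P *t M).
Proof. by apply/matrixP => i j; rewrite !mxE mulrCA. Qed.

Lemma castmxD (K : comNzRingType) m n m' n' (e : (m = m') * (n = n'))
  (M N : 'M[K]_(m, n)) : castmx e (M + N) = castmx e M + castmx e N.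
Proof. by apply/matrixP => i j; rewrite !(castmxE, mxE). Qed.

Lemma castmxZ (K : comNzRingType) m n m' n' (e : (m = m') * (n = n')) a
  (M : 'M[K]_(m, n)) : castmx e (a *: M) = a *: castmx e M.
Proof. by apply/matrixP => i j; rewrite !(castmxE, mxE). Qed.

Section Basis.
Variable R : realType.

Definition tbasis i j k : 'cV[R[i]]_(3 * 3 * 3) :=
  Defs.vbasis R i *t Defs.vbasis R j *t Defs.vbasis R k.

Lemma tens_delta_mx m n (i : 'I_m) (j : 'I_n) :
  (delta_mx i 0 : 'cV[R[i]]_m) *t (delta_mx j 0 : 'cV_n) =
  (delta_mx (mxtens_index (i, j)) 0 : 'cV_(m * n)).
Proof.
apply/matrixP => a b; case: (mxtens_indexP a) => k l.
rewrite !mxE !mxtens_indexK /= (can_eq (@mxtens_indexK m n)) xpair_eqE.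
by rewrite [b]ord1 !andbT -natrM mulnb.
Qed.

Lemma eq_vbasis2 (M N : 'M[R[i]]_(3 * 3)) :
  (forall i j, M *m (Defs.vbasis R i *t Defs.vbasis R j) =
    N *m (Defs.vbasis R i *t Defs.vbasis R j)) ->
  M = N.
Proof.
move=> MN; apply/matrixP => a b; case: (mxtens_indexP b) => i j.
have /matrixP/(_ a 0) := MN i j.
by rewrite /Defs.vbasis !col_tens_basis !mxE.
Qed.

Lemma eq_tbasis (M N : 'M[R[i]]_(3 * 3 * 3)) :
  (forall i j k, M *m tbasis i j k = N *m tbasis i j k) -> M = N.
Proof.
move=> MN; apply/matrixP => a b; case: (mxtens_indexP b) => ij k.
case: (mxtens_indexP ij) => i j.
have /matrixP/(_ a 0) := MN i j k.
by rewrite /tbasis /Defs.vbasis tens_delta_mx !col_tens_basis !mxE.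
Qed.

End Basis.

(** * From the shifted operators to the abstract blocks *)

Section BraidRelation.
Variables (R : realType) (p : R) (kappa : R[i]) (s : R[i] -> R[i]).
Hypothesis sN : forall x, s (- x) = - s x.
Hypothesis three_term : forall a b c d,
  s a * s b * s (c + d - a - b) * s (c - d)
  - s c * s (a + b - c) * s (d - b) * s (a - d)
  + s d * s (a + b - d) * s (c - b) * s (a - c) = 0.
Let eta := 2 * kappa.
Hypothesis coefAE : forall u x, coefA p kappa u x = dynA s eta u x.
Hypothesis coefBE : forall u x, Defs.coefB p kappa u x = dynB s eta u x.
Hypothesis coefcE : forall x phi (i : 'I_3), regular p kappa x phi ->
  (-1) ^+ parity i * (coefc p kappa x / coefc p kappa ((-1) ^+ parity i * x))
  = dynD s eta (i == ord_max) x.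
Hypothesis s_neq0 : forall u, (s u != 0) = (theta p (cpow p u) != 0).

Definition shift12 x phi :=
  dyn_shift (fun phi => op12 (Rop p kappa x phi)) kappa ord_max phi.
Definition shift23 x phi :=
  dyn_shift (fun phi => op23 (Rop p kappa x phi)) (- kappa) ord0 phi.

Lemma shift12E x phi i j k :
  shift12 x phi *m tbasis R i j k =
  Rimage p kappa x (phi + kappa *: weight R k) i j *t Defs.vbasis R k.
Proof. by rewrite /shift12 /tbasis dyn_shiftE op12E RopE. Qed.

Lemma shift23E x phi i j k :
  shift23 x phi *m tbasis R i j k =
  castmx (mulnA 3 3 3, mulnA 1 1 1)
    (Defs.vbasis R i *t Rimage p kappa x (phi - kappa *: weight R i) j k).
Proof. by rewrite /shift23 /tbasis dyn_shiftE op23E RopE scaleNr. Qed.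

(** The entry on a repeated letter does not involve the dynamical parameter, so regularity at an
    arbitrary [phi'] serves. *)
Lemma shift12_diag x phi phi' i k : regular p kappa x phi' ->
  shift12 x phi *m tbasis R i i k =
  dynD s eta (i == ord_max) x *: tbasis R i i k.
Proof.
move=> reg; rewrite shift12E /Rimage eqxx tensmxZl; congr (_ *: _).
exact: coefcE reg.
Qed.

Lemma shift23_diag x phi phi' i k : regular p kappa x phi' ->
  shift23 x phi *m tbasis R i k k =
  dynD s eta (k == ord_max) x *: tbasis R i k k.
Proof.
move=> reg; rewrite shift23E /Rimage eqxx tensmxZr castmxZ tensmxA.
by congr (_ *: _); apply: coefcE reg.
Qed.

Definition swap_sign i j : R[i] := (-1) ^+ (parity i + parity j).

Lemma shift12_off x (phi : 'rV[R[i]]_3) i j k u : i != j ->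
  u = (phi + kappa *: weight R k) 0 i - (phi + kappa *: weight R k) 0 j ->
  shift12 x phi *m tbasis R i j k =
  dynA s eta u x *: tbasis R i j k
  + (swap_sign i j * dynB s eta u x) *: tbasis R j i k.
Proof.
move=> /negPf ij ->; rewrite shift12E /Rimage ij tensmxDl !tensmxZl.
by rewrite coefAE coefBE.
Qed.

Lemma shift23_off x (phi : 'rV[R[i]]_3) i j k u : j != k ->
  u = (phi - kappa *: weight R i) 0 j - (phi - kappa *: weight R i) 0 k ->
  shift23 x phi *m tbasis R i j k =
  dynA s eta u x *: tbasis R i j k
  + (swap_sign j k * dynB s eta u x) *: tbasis R i k j.
Proof.
move=> /negPf jk ->; rewrite shift23E /Rimage jk tensmxDr !tensmxZr.
rewrite castmxD !castmxZ !tensmxA.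
by rewrite coefAE coefBE.
Qed.

Lemma shift_entry (phi : 'rV[R[i]]_3) (c : R[i]) (k i : 'I_3) :
  (phi + c *: weight R k) 0 i = phi 0 i + c * ((-1) ^+ parity k * (i == k)%:R).
Proof. by rewrite !mxE eqxx. Qed.

Lemma swap_signC i j : swap_sign i j = swap_sign j i.
Proof. by rewrite /swap_sign addnC. Qed.

Lemma swap_signP i j : swap_sign i j = 1 \/ swap_sign i j = - 1.
Proof. by rewrite /swap_sign -signr_odd; case: odd; [right|left]. Qed.

Section Fixed.
Variables (x y : R[i]) (phi : 'rV[R[i]]_3).
Hypothesis reg : forall (z : R[i]) (j : 'I_3), z \in [:: x; y; x + y] ->
  regular p kappa z (phi + kappa *: weight R j) /\
  regular p kappa z (phi - kappa *: weight R j).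

Lemma shift_neq0 k i j : i != j ->
  s ((phi + kappa *: weight R k) 0 i - (phi + kappa *: weight R k) 0 j) != 0 /\
  s ((phi - kappa *: weight R k) 0 i - (phi - kappa *: weight R k) 0 j) != 0.
Proof.
move=> ij; have /(@reg x k)[r1 r2] : x \in [:: x; y; x + y] by rewrite inE eqxx.
by rewrite !s_neq0; split; [case: r1 => _ _ _ -> | case: r2 => _ _ _ ->].
Qed.

Lemma eta_neq0 z : z \in [:: x; y; x + y] -> s (eta - z) != 0.
Proof. by move=> /(@reg _ ord0)[[_ _ ? _] _]; rewrite s_neq0. Qed.

Let x0 : s (eta - x) != 0. Proof. by rewrite eta_neq0 // !inE eqxx. Qed.
Let y0 : s (eta - y) != 0. Proof. by rewrite eta_neq0 // !inE eqxx orbT. Qed.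
Let xy0 : s (eta - (x + y)) != 0. Proof. by rewrite eta_neq0 // !inE eqxx !orbT. Qed.
Let diag_reg z : z \in [:: x; y; x + y] ->
  regular p kappa z (phi + kappa *: weight R ord0).
Proof. by move=> /(@reg _ ord0)[]. Qed.

Section TwoEqual.
Variables (i j : 'I_3).
Hypothesis ij : i != j.
Let ji : j != i. Proof. by rewrite eq_sym. Qed.
Let w := (phi - kappa *: weight R i) 0 i - (phi - kappa *: weight R i) 0 j.
Let w' := (phi + kappa *: weight R i) 0 i - (phi + kappa *: weight R i) 0 j.

(** The letter that causes the shift is v_i itself. It moves phi_i by (-1)^p(i) kappa in [w'] and by
    the opposite amount in [w]; hence the gap 2 kappa and its sign. *)
Let w'E : w' = w + (-1) ^+ (i == ord_max) * eta.
Proof.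
rewrite /w' /w -scaleNr !shift_entry eqxx (negPf ji) !mulr1 !mulr0 /eta /parity; ring.
Qed.
Let w0 : s w != 0. Proof. by have [] := shift_neq0 i ij. Qed.
Let w'0 : s w' != 0. Proof. by have [] := shift_neq0 i ij. Qed.

Let O12iji z : shift12 z phi *m tbasis R i j i =
  dynA s eta w' z *: tbasis R i j i
  + (swap_sign i j * dynB s eta w' z) *: tbasis R j i i.
Proof. exact: shift12_off. Qed.

Let O12jii z : shift12 z phi *m tbasis R j i i =
  dynA s eta (- w') z *: tbasis R j i i
  + (swap_sign i j * dynB s eta (- w') z) *: tbasis R i j i.
Proof. by rewrite swap_signC; apply: shift12_off; rewrite // /w' opprB. Qed.

Let O23iij z : shift23 z phi *m tbasis R i i j =
  dynA s eta w z *: tbasis R i i j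
  + (swap_sign i j * dynB s eta w z) *: tbasis R i j i.
Proof. exact: shift23_off. Qed.

Let O23iji z : shift23 z phi *m tbasis R i j i =
  dynA s eta (- w) z *: tbasis R i j i
  + (swap_sign i j * dynB s eta (- w) z) *: tbasis R i i j.
Proof. by rewrite swap_signC; apply: shift23_off; rewrite // /w opprB. Qed.

Let X12 z := shift12 z phi.
Let X23 z := shift23 z phi.

Lemma braid_tbasis_two_equal :
  [/\ braid_at X12 X23 x y (tbasis R i i j), braid_at X12 X23 x y (tbasis R i j i)
    & braid_at X12 X23 x y (tbasis R j i i)].
Proof.
apply: (braid_two_equal sN three_term x0 y0 xy0 w'E w0 w'0 (swap_signP i j)).
- by move=> z /diag_reg; apply: shift12_diag.
- by move=> z /diag_reg; apply: shift23_diag.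
- exact: O12iji.
- exact: O12jii.
- exact: O23iij.
- exact: O23iji.
Qed.
End TwoEqual.

Lemma braid_tbasis_equal i :
  braid_at (fun z => shift12 z phi) (fun z => shift23 z phi) x y (tbasis R i i i).
Proof.
apply: (braid_equal (d := dynD s eta (i == ord_max))).
- by move=> z /diag_reg; apply: shift12_diag.
- by move=> z /diag_reg; apply: shift23_diag.
Qed.

Lemma braid_tbasis_distinct i j k : i != j -> j != k -> i != k ->
  braid_at (fun z => shift12 z phi) (fun z => shift23 z phi) x y (tbasis R i j k).
Proof.
move=> ij jk ik.
have [ji kj ki] : [/\ j != i, k != j & k != i] by rewrite ![_ == i]eq_sym (eq_sym k).
pose u := phi 0 i - phi 0 j; pose v := phi 0 j - phi 0 k.
(* The weight of v_c moves phi_c alone, so with three distinct letters the shifts leave every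
   relevant difference unchanged. *)
have gapE a b c (e : R[i]) : a != c -> b != c ->
    (phi + e *: weight R c) 0 a - (phi + e *: weight R c) 0 b = phi 0 a - phi 0 b.
  by move=> /negPf ac /negPf bc; rewrite !shift_entry ac bc !mulr0 !addr0.
have gap_neq0 a b c : a != b -> a != c -> b != c -> s (phi 0 a - phi 0 b) != 0.
  by move=> ab ac bc; have [+ _] := shift_neq0 c ab; rewrite gapE.
have u0 : s u != 0 by apply: (gap_neq0 i j k).
have v0 : s v != 0 by apply: (gap_neq0 j k i).
have uvE : u + v = phi 0 i - phi 0 k by rewrite /u /v addrA subrK.
have uv0 : s (u + v) != 0 by rewrite uvE; apply: (gap_neq0 i k j).
have O12 a b c : a != b -> a != c -> b != c -> forall z,
    shift12 z phi *m tbasis R a b c = dynA s eta (phi 0 a - phi 0 b) z *: tbasis R a b c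
     + (swap_sign a b * dynB s eta (phi 0 a - phi 0 b) z) *: tbasis R b a c.
  by move=> ab ac bc z; apply: shift12_off; rewrite ?gapE.
have O23 a b c : b != c -> b != a -> c != a -> forall z,
    shift23 z phi *m tbasis R a b c = dynA s eta (phi 0 b - phi 0 c) z *: tbasis R a b c
     + (swap_sign b c * dynB s eta (phi 0 b - phi 0 c) z) *: tbasis R a c b.
  by move=> bc ba ca z; apply: shift23_off; rewrite // -scaleNr gapE.
have NuE : - u = phi 0 j - phi 0 i by rewrite opprB.
have NvE : - v = phi 0 k - phi 0 j by rewrite opprB.
apply: (braid_distinct sN three_term x0 y0 xy0 u0 v0 uv0 (swap_signP i j)
  (swap_signP j k) (sik := swap_sign i k)
  (jik := tbasis R j i k) (ikj := tbasis R i k j)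
  (jki := tbasis R j k i) (kij := tbasis R k i j) (kji := tbasis R k j i)).
- exact: O12.
- by move=> z; rewrite NuE swap_signC; apply: O12.
- by move=> z; rewrite uvE; apply: O12.
- exact: O12.
- exact: O23.
- by move=> z; rewrite NvE swap_signC; apply: O23.
- by move=> z; rewrite uvE; apply: O23.
- exact: O23.
Qed.

Lemma braid_relation :
  shift12 x phi *m shift23 (x + y) phi *m shift12 y phi
  = shift23 y phi *m shift12 (x + y) phi *m shift23 x phi.
Proof.
apply: eq_tbasis => i j k.
apply: (@braid_atE _ _ (fun z => shift12 z phi) (fun z => shift23 z phi)).
have [<-|ij] := eqVneq i j; have [<-|ik] := eqVneq i k.
- exact: braid_tbasis_equal.
- by have [H _ _] := braid_tbasis_two_equal ik; apply: H.
- by have [_ H _] := braid_tbasis_two_equal ij; apply: H.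
have [<-|jk] := eqVneq j k; last exact: braid_tbasis_distinct.
by rewrite eq_sym in ij; have [_ _ H] := braid_tbasis_two_equal ij; apply: H.
Qed.

End Fixed.

Lemma unitarity_relation x phi :
  regular p kappa x phi -> regular p kappa (- x) phi ->
  Rop p kappa x phi *m Rop p kappa (- x) phi = 1%:M.
Proof.
move=> rx rNx; apply: eq_vbasis2 => i j; rewrite mul1mx -mulmxA RopE /Rimage.
have x0 : s (eta - x) != 0 by rewrite s_neq0; case: rx.
have Nx0 : s (eta + x) != 0 by rewrite s_neq0; case: rNx; rewrite opprK.
have [<-|ij] := eqVneq i j.
  rewrite -scalemxAr RopE /Rimage eqxx scalerA (coefcE _ rx) (coefcE _ rNx).
  rewrite /dynD !mulrN !opprK -[RHS]scale1r; congr (_ *: _).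
  case: (i == ord_max); rewrite ?expr1 ?expr0 ?mulN1r ?mul1r ?opprK.
    by rewrite mulf_div [X in _ / X]mulrC divff // mulf_neq0.
  by rewrite !divff ?mul1r.
have ji : j != i by rewrite eq_sym.
have u0 : s (phi 0 i - phi 0 j) != 0 by rewrite s_neq0; case: rx => _ _ _ ->.
rewrite mulmxDr -!scalemxAr !RopE /Rimage (negPf ij) (negPf ji) !coefAE !coefBE.
have -> : phi 0 j - phi 0 i = - (phi 0 i - phi 0 j) by rewrite opprB.
have := swap_signC i j; rewrite /swap_sign => <-.
exact: (dyn_unitarity sN three_term _ _ u0 x0 Nx0 (swap_signP i j)).
Qed.

End BraidRelation.

(** * The finite triple product and lattice sums *)

Definition box (N : nat) : seq int := [seq i%:Z - N%:Z | i <- iota 0 N.*2.+1].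

Arguments box : simpl never.

Lemma mem_box N (k : int) : (k \in box N) = (`|k| <= N)%N.
Proof.
apply/mapP/idP => [[n]|kN]; first by rewrite mem_iota => nN ->; lia.
by exists (absz (k + N%:Z)); [rewrite mem_iota|]; lia.
Qed.

Lemma uniq_box N : uniq (box N).
Proof. by rewrite map_inj_uniq ?iota_uniq // => i j; lia. Qed.

Lemma big_sub_uniq (K : nmodType) (I : eqType) (s1 s2 : seq I) (f : I -> K) :
  uniq s1 -> uniq s2 -> {subset s1 <= s2} ->
  \sum_(i <- s2) f i = \sum_(i <- s1) f i + \sum_(i <- s2 | i \notin s1) f i.
Proof.
move=> u1 u2 s12; rewrite (bigID (mem s1)) /=; congr (_ + _).
rewrite -big_filter; apply/perm_big/uniq_perm; rewrite ?filter_uniq // => i.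
by rewrite mem_filter andb_idr //; apply: s12.
Qed.

Lemma box_sum_shift (K : zmodType) N (f : int -> K) :
  f (- N%:Z - 1) = 0 -> f N%:Z = 0 ->
  \sum_(k <- box N) f (k - 1) = \sum_(k <- box N) f k.
Proof.
move=> f1 f2; rewrite !big_map -[iota _ _]/(index_iota 0 N.*2.+1).
rewrite big_nat_recl // [RHS]big_nat_recr //=.
rewrite (_ : 0%:Z - N%:Z - 1 = - N%:Z - 1) ?f1 ?add0r; last by lia.
rewrite (_ : N.*2%:Z - N%:Z = N%:Z) ?f2 ?addr0; last by lia.
by apply: eq_bigr => i _; congr f; lia.
Qed.

Section FiniteTripleProduct.
Variables (K : fieldType) (r : K).
Let q := r ^+ 2.
Hypothesis r0 : r != 0.
Hypothesis q_neq1 : forall j, (0 < j)%N -> 1 - q ^+ j != 0.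

Definition qfact j := \prod_(0 <= i < j) (1 - q ^+ i.+1).

(* 1/(q;q)_k, extended by 0 to k < 0 so that [qfactV_pred] holds for all integers. *)
Definition qfactV (k : int) := if k is Posz j then (qfact j)^-1 else 0.

(** The q-binomial coefficient with upper index 2n and lower index n + k. *)
Definition qcoef n (k : int) := qfact n.*2 * qfactV (n%:Z + k) * qfactV (n%:Z - k).

(** As r is a square root of q, this is (-1)^k q^(k(k-1)/2) z^k without halving in [int]. *)
Definition jterm z (k : int) := (-1) ^ k * r ^ (k * k - k) * z ^ k.

Definition theta_part z n :=
  \prod_(0 <= m < n) ((1 - q ^+ m * z) * (1 - q ^+ m.+1 / z)).

Lemma q0 : q != 0. Proof. by rewrite expf_neq0. Qed.

Lemma qfactV_pred (k : int) : qfactV (k - 1) = (1 - q ^ k) * qfactV k.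
Proof.
case: k => [[|j]|j].
(* At k = 0 the factor 1 - q^0 vanishes, in accordance with the default value 0 at - 1. *)
- by rewrite expr0z subrr mul0r.
- rewrite (_ : j.+1%:Z - 1 = j%:Z); last by lia.
  rewrite /= /qfact big_nat_recr //= invfM mulrCA -exprnP divff ?mulr1 ?q_neq1 //.
- by rewrite (_ : Negz j - 1 = Negz j.+1) ?mulr0 //; lia.
Qed.

Lemma qcoef_out n (k : int) : (n < `|k|)%N -> qcoef n k = 0.
Proof.
rewrite /qcoef => nk; have [k0|k0] : (exists j, n%:Z - k = Negz j) \/
    (exists j, n%:Z + k = Negz j).
- case: k nk => k nk; [left; exists (k - n.+1)%N | right; exists (k - n)%N]; lia.
- by case: k0 => j ->; rewrite mulr0.
by case: k0 => j ->; rewrite mulr0 mul0r.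
Qed.

(** Multiplication by (1 - q^n z)(1 - q^(n+1) / z) = 1 + q^(2n+1) - q^n z - q^(n+1) / z, read on the
    coefficient of [jterm z k]. With a = n + k and b = n - k, all terms share the factor
    [qfactV (a + 1) * qfactV (b + 1)], and the rest is polynomial in q, q^a and q^b. *)
Lemma qcoef_rec n (k : int) : qcoef n.+1 k =
  (1 + q ^+ n.*2.+1) * qcoef n k + q ^ (n%:Z - k + 1) * qcoef n (k - 1)
  + q ^ (n%:Z + k + 1) * qcoef n (k + 1).
Proof.
rewrite /qcoef doubleS /qfact !big_nat_recr //= -/(qfact _).
set a := n%:Z + k; set b := n%:Z - k.
rewrite (_ : n.+1%:Z + k = a + 1); last by rewrite /a; lia.
rewrite (_ : n.+1%:Z - k = b + 1); last by rewrite /b; lia.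
rewrite (_ : n%:Z + (k - 1) = a - 1); last by rewrite /a; lia.
rewrite (_ : n%:Z - (k - 1) = b + 1); last by rewrite /b; lia.
rewrite (_ : n%:Z + (k + 1) = a + 1); last by rewrite /a; lia.
rewrite (_ : n%:Z - (k + 1) = b - 1); last by rewrite /b; lia.
have E c : qfactV c = (1 - q ^ (c + 1)) * qfactV (c + 1).
  by rewrite -qfactV_pred addrK.
rewrite (qfactV_pred a) (qfactV_pred b) (E a) (E b).
rewrite (_ : q ^+ n.*2.+1 = q ^ (a + b + 1)); last first.
  by rewrite exprnP; congr (_ ^ _); rewrite /a /b; lia.
rewrite (_ : q ^+ n.*2.+2 = q ^ (a + b + 1 + 1)); last first.
  by rewrite exprnP; congr (_ ^ _); rewrite /a /b; lia.
rewrite !expfzDr ?q0 // expr1z.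
ring.
Qed.

(** The signs cancel, so for r, rho > 0 the terms at - rho are positive. They serve as the majorant
    of the theta series at modulus rho. *)
Lemma jtermN z (k : int) : z != 0 -> jterm (- z) k = r ^ (k * k - k) * z ^ k.
Proof.
move=> z0; have sq1 : (-1 : K) ^ k * (-1) ^ k = 1.
  by rewrite -exprzMl ?unitrN1 // mulrNN mulr1 exp1rz.
rewrite /jterm (_ : - z = -1 * z); last by rewrite mulN1r.
rewrite exprzMl ?unitrN1 ?unitfE //.
transitivity ((-1) ^ k * (-1) ^ k * (r ^ (k * k - k) * z ^ k)); first by ring.
by rewrite sq1 mul1r.
Qed.

Lemma jterm_pred z (k : int) : z != 0 ->
  z * jterm z (k - 1) = - (q ^ (1 - k) * jterm z k).
Proof.
move=> z0; have n1 : (-1 : K) != 0 by rewrite oppr_eq0 oner_neq0.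
rewrite /jterm (_ : (k - 1) * (k - 1) - (k - 1) = (k * k - k) + 2 * (1 - k));
  last by ring.
rewrite /q (exprnP r 2) exprz_exp [r ^ (_ + _)]expfzDr //.
rewrite [(-1) ^ (k - 1)]expfzDr // [z ^ (k - 1)]expfzDr // -!invr_expz !expr1z.
by rewrite invrN1; field.
Qed.

Lemma jterm_succ z (k : int) : z != 0 ->
  z^-1 * jterm z (k + 1) = - (q ^ k * jterm z k).
Proof.
move=> z0; have := jterm_pred (k + 1) z0; rewrite addrK => E.
have qk : q ^ k != 0 by rewrite expfz_neq0 ?q0.
rewrite (_ : 1 - (k + 1) = - k) in E; last by ring.
apply: (mulfI z0); rewrite mulrA divff // mul1r.
rewrite (_ : z * _ = - (q ^ k * (z * jterm z k))); last by ring.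
by rewrite E -invr_expz; field.
Qed.

(** The finite form of the Jacobi triple product. The box keeps its size N during the induction on
    n, so that shifting k only affects boundary terms, which vanish while n < N. *)
Lemma theta_part_sum z n N : z != 0 -> (n <= N)%N ->
  theta_part z n = \sum_(k <- box N) qcoef n k * jterm z k.
Proof.
move=> z0; elim: n => [_|n IH nN].
  rewrite /theta_part big_nil (bigD1_seq 0) ?uniq_box ?mem_box //=.
  have -> : qcoef 0 0 = 1.
    by rewrite /qcoef /qfact !(addr0, subr0) /= /qfact !big_nil invr1 !mulr1.
  have -> : jterm z 0 = 1 by rewrite /jterm mulr0 subr0 !expr0z !mulr1.
  rewrite mulr1 big1 ?addr0 // => k k0.
  by rewrite qcoef_out ?mul0r //; lia.
rewrite /theta_part big_nat_recr //= -/(theta_part z n) (IH (ltnW nN)) mulr_suml.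
transitivity (\sum_(k <- box N) (1 + q ^+ n.*2.+1) * (qcoef n k * jterm z k)
  + \sum_(k <- box N) q ^ (n%:Z - k + 1) * (qcoef n (k - 1) * jterm z k)
  + \sum_(k <- box N) q ^ (n%:Z + k + 1) * (qcoef n (k + 1) * jterm z k)); last first.
  rewrite -!big_split; apply: eq_bigr => k _ /=; rewrite qcoef_rec; ring.
have -> : \sum_(k <- box N) q ^ (n%:Z - k + 1) * (qcoef n (k - 1) * jterm z k)
   = - \sum_(k <- box N) q ^+ n * z * (qcoef n k * jterm z k).
  rewrite -[in RHS]box_sum_shift; first last.
  - by rewrite qcoef_out ?mul0r ?mulr0 //; lia.
  - by rewrite qcoef_out ?mul0r ?mulr0 //; lia.
  rewrite -sumrN; apply: eq_bigr => k _.
  rewrite (_ : n%:Z - k + 1 = n%:Z + (1 - k)); last by ring.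
  rewrite expfzDr ?q0 // -exprnP.
  rewrite (_ : q ^+ n * z * _ = q ^+ n * qcoef n (k - 1) * (z * jterm z (k - 1)));
    last by ring.
  by rewrite jterm_pred //; ring.
have -> : \sum_(k <- box N) q ^ (n%:Z + k + 1) * (qcoef n (k + 1) * jterm z k)
   = - \sum_(k <- box N) q ^+ n.+1 / z * (qcoef n k * jterm z k).
  rewrite -[LHS]box_sum_shift; first last.
  - by rewrite qcoef_out ?mul0r ?mulr0 //; lia.
  - by rewrite qcoef_out ?mul0r ?mulr0 //; lia.
  rewrite -sumrN; apply: eq_bigr => k _; rewrite subrK.
  rewrite (_ : n%:Z + (k - 1) + 1 = n.+1%:Z + (k - 1)); last by lia.
  rewrite expfzDr ?q0 // -exprnP.
  have := jterm_succ (k - 1) z0; rewrite subrK => E.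
  rewrite (_ : q ^+ n.+1 / z * _ = q ^+ n.+1 * qcoef n k * (z^-1 * jterm z k));
    last by ring.
  by rewrite E; ring.
rewrite -!sumrN -!big_split; apply: eq_bigr => k _ /=.
rewrite (_ : q ^+ n.*2.+1 = q ^+ n * q ^+ n * q); last first.
  by rewrite -exprD -exprSr addnn.
by rewrite exprS; field.
Qed.

End FiniteTripleProduct.

(** The pairs (m, l) with m + l even, resp. odd for [lattice_odd]. Since a and b range independently
    over a box, summation over these regions factors exactly for every N. *)
Definition lattice_even N : seq (int * int) :=
  [seq (a + b, a - b) | a <- box N, b <- box N].
Definition lattice_odd N : seq (int * int) :=
  [seq (a + b + 1, a - b) | a <- box N, b <- box N].
Definition lattice_box N : seq (int * int) := [seq (m, l) | m <- box N, l <- box N].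

Lemma mem_lattice_box N ml :
  (ml \in lattice_box N) = (`|ml.1| <= N)%N && (`|ml.2| <= N)%N.
Proof.
apply/allpairsP/andP => [[[a b] [/= aN bN ->]]|[mN lN]].
  by rewrite -!mem_box.
by exists ml; rewrite !mem_box; case: ml mN lN.
Qed.

Lemma uniq_lattice_box N : uniq (lattice_box N).
Proof. by apply: allpairs_uniq; rewrite ?uniq_box // => -[? ?] [? ?]. Qed.

Lemma uniq_lattice N : uniq (lattice_even N ++ lattice_odd N).
Proof.
rewrite cat_uniq; apply/and3P; split.
- apply: allpairs_uniq; rewrite ?uniq_box // => -[a b] [c d] _ _ /= [].
  by move=> *; congr (_, _); lia.
- apply/hasPn => _ /allpairsP[[a b] [_ _ ->]]; apply/negP.
  move=> /allpairsP[[c d] [_ _ /= []]].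
  lia.
- apply: allpairs_uniq; rewrite ?uniq_box // => -[a b] [c d] _ _ /= [].
  by move=> *; congr (_, _); lia.
Qed.

Lemma lattice_box_sub N : {subset lattice_box N <= lattice_even N ++ lattice_odd N}.
Proof.
move=> [m l]; rewrite mem_lattice_box mem_cat => /andP[/= mN lN].
have [e|o] := boolP (2 %| m + l)%Z.
  apply/orP; left; apply/allpairsP; exists (((m + l) %/ 2)%Z, ((m - l) %/ 2)%Z).
  by rewrite !mem_box /=; split; [lia|lia|congr (_, _); lia].
(* Here m + l and m - l are odd: each rounded half loses 1/2, which the + 1 in [lattice_odd]
   restores. *)
apply/orP; right; apply/allpairsP; exists (((m + l) %/ 2)%Z, ((m - l) %/ 2)%Z).
by rewrite !mem_box /=; split; [lia|lia|congr (_, _); lia].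
Qed.

Lemma sub_lattice_box N :
  {subset lattice_even N ++ lattice_odd N <= lattice_box N.*2.+1}.
Proof.
move=> ml; rewrite mem_cat mem_lattice_box.
by case/orP => /allpairsP[[a b] [/=]]; rewrite !mem_box => aN bN -> /=; lia.
Qed.

Section RankTwo.
Variables (K : fieldType) (r : K).
Hypothesis r0 : r != 0.

Lemma jterm_mul x z (m l : int) : x != 0 -> z != 0 ->
  jterm r (x * z) m * jterm r (x / z) l =
  (-1) ^ (m + l) * r ^ (m * m - m + (l * l - l)) * x ^ (m + l) * z ^ (m - l).
Proof.
move=> x0 z0; have n1 : (-1 : K) != 0 by rewrite oppr_eq0 oner_neq0.
have zl : z ^ l != 0 by rewrite expfz_neq0.
rewrite /jterm !exprzMl ?unitfE ?invr_eq0 // exprz_inv.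
rewrite [(-1) ^ (_ + _)]expfzDr // [r ^ (_ + (_ - _))]expfzDr //.
rewrite [x ^ (_ + _)]expfzDr // [z ^ (_ - _)]expfzDr //.
ring.
Qed.

Lemma sqr_sign (a : int) : (-1 : K) ^ (2 * a) = 1.
Proof. by rewrite -exprz_exp -exprnP sqrrN expr1n exp1rz. Qed.

Lemma jterm_even x z (a b : int) : x != 0 -> z != 0 ->
  jterm r (x * z) (a + b) * jterm r (x / z) (a - b) =
  (r ^ (2 * a * a - 2 * a) * x ^ (2 * a)) * (r ^ (2 * b * b) * z ^ (2 * b)).
Proof.
move=> x0 z0; rewrite jterm_mul //.
rewrite (_ : a + b + (a - b) = 2 * a); last by ring.
rewrite (_ : a + b - (a - b) = 2 * b); last by ring.
rewrite (_ : _ - (a + b) + _ = (2 * a * a - 2 * a) + 2 * b * b); last by ring.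
by rewrite sqr_sign [r ^ (_ + 2 * b * b)]expfzDr //; ring.
Qed.

Lemma jterm_odd x z (a b : int) : x != 0 -> z != 0 ->
  jterm r (x * z) (a + b + 1) * jterm r (x / z) (a - b) =
  (r ^ (2 * a * a) * x ^ (2 * a + 1)) * (- r ^ (2 * b * b + 2 * b) * z ^ (2 * b + 1)).
Proof.
move=> x0 z0; rewrite jterm_mul //.
have n1 : (-1 : K) != 0 by rewrite oppr_eq0 oner_neq0.
rewrite (_ : a + b + 1 + (a - b) = 2 * a + 1); last by ring.
rewrite (_ : a + b + 1 - (a - b) = 2 * b + 1); last by ring.
rewrite (_ : _ - (a + b + 1) + _ = 2 * a * a + (2 * b * b + 2 * b)); last by ring.
rewrite [(-1) ^ _]expfzDr // sqr_sign expr1z.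
by rewrite [r ^ (2 * a * a + _)]expfzDr //; ring.
Qed.

Definition lattice_sum N (x z : K) :=
  \sum_(ml <- lattice_even N ++ lattice_odd N)
    jterm r (x * z) ml.1 * jterm r (x / z) ml.2.

Lemma lattice_sumE N x z : x != 0 -> z != 0 -> lattice_sum N x z =
  (\sum_(a <- box N) r ^ (2 * a * a - 2 * a) * x ^ (2 * a)) *
  (\sum_(b <- box N) r ^ (2 * b * b) * z ^ (2 * b)) +
  (\sum_(a <- box N) r ^ (2 * a * a) * x ^ (2 * a + 1)) *
  (\sum_(b <- box N) - r ^ (2 * b * b + 2 * b) * z ^ (2 * b + 1)).
Proof.
move=> x0 z0; rewrite /lattice_sum big_cat /= /lattice_even /lattice_odd.
rewrite !big_allpairs_dep !mulr_suml.
congr (_ + _); apply: eq_bigr => a _; rewrite mulr_sumr; apply: eq_bigr => b _.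
- exact: jterm_even.
- exact: jterm_odd.
Qed.

End RankTwo.

(** * From rank two to the Pfaffian relation *)

Section Pfaffian.
Variable K : fieldType.

Definition minor3 (T : Type) (f : T -> T -> K) x1 x2 x3 y1 y2 y3 :=
  f x1 y1 * (f x2 y2 * f x3 y3 - f x2 y3 * f x3 y2)
  - f x1 y2 * (f x2 y1 * f x3 y3 - f x2 y3 * f x3 y1)
  + f x1 y3 * (f x2 y1 * f x3 y2 - f x2 y2 * f x3 y1).

Lemma minor3_rank2 (T : Type) (f g f' g' : T -> K) x1 x2 x3 y1 y2 y3 :
  minor3 (fun x y => f x * g y + f' x * g' y) x1 x2 x3 y1 y2 y3 = 0.
Proof. rewrite /minor3; ring. Qed.

Lemma minor3_scale (T : Type) (a b : T -> K) (f : T -> T -> K) x1 x2 x3 y1 y2 y3 :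
  minor3 (fun x y => a x * b y * f x y) x1 x2 x3 y1 y2 y3 =
  a x1 * a x2 * a x3 * (b y1 * b y2 * b y3) * minor3 f x1 x2 x3 y1 y2 y3.
Proof. rewrite /minor3; ring. Qed.

(* The minor with rows x, y, z and columns x, y, w is f x y times the Pfaffian. *)
Lemma pfaffian_rank2 (T : Type) (f : T -> T -> K) x y z w :
  (forall a b, f b a = - f a b) -> (forall a, f a a = 0) ->
  (forall x1 x2 x3 y1 y2 y3, minor3 f x1 x2 x3 y1 y2 y3 = 0) ->
  f x y * f z w - f x z * f y w + f x w * f y z = 0.
Proof.
move=> fN f0 f3.
have H a b c d : f a b * (f a b * f c d - f a c * f b d + f a d * f b c) = 0.
  rewrite -[RHS](f3 a b c a b d) /minor3 !f0 (fN a b) (fN a c) (fN b c); ring.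
(* A nonzero entry in the row of x can be cancelled after permuting y, z, w. If all three vanish, so
   does each term of the Pfaffian. *)
have [xy0|] := eqVneq (f x y) 0; last first.
  by move=> xy; apply: (mulfI xy); rewrite H mulr0.
have [xz0|] := eqVneq (f x z) 0; last first.
  by move=> xz; apply: (mulfI xz); rewrite mulr0 -oppr0 -(H x z y w) (fN y z); ring.
have [xw0|] := eqVneq (f x w) 0; last first.
  by move=> xw; apply: (mulfI xw); rewrite mulr0 -(H x w y z) (fN z w) (fN y w); ring.
by rewrite xy0 xz0 xw0 !mul0r subrr addr0.
Qed.

Lemma three_term_of_minor3 (s : K -> K) : 2 != 0 :> K ->
  (forall x, s (- x) = - s x) ->
  (forall x1 x2 x3 y1 y2 y3,
    minor3 (fun x y => s (x + y) * s (x - y)) x1 x2 x3 y1 y2 y3 = 0) ->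
  forall a b c d, s a * s b * s (c + d - a - b) * s (c - d)
    - s c * s (a + b - c) * s (d - b) * s (a - d)
    + s d * s (a + b - d) * s (c - b) * s (a - c) = 0.
Proof.
move=> two0 sN s3 a b c d.
have s0 : s 0 = 0.
  apply: (mulfI two0); rewrite mulr0 mulr_natl mulr2n.
  by rewrite -{1}[0]oppr0 sN addNr.
have fN x y : s (y + x) * s (y - x) = - (s (x + y) * s (x - y)).
  by rewrite -(opprB x y) sN addrC mulrN.
have f0 x : s (x + x) * s (x - x) = 0 by rewrite subrr s0 mulr0.
(* The points solve x + y = a, x - y = b, x + z = c, x + w = d. *)
rewrite -[RHS](pfaffian_rank2 ((a + b) / 2) ((a - b) / 2) (c - (a + b) / 2)
  (d - (a + b) / 2) fN f0 s3) !mulrA.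
by congr (_ * _ * _ * _ - _ * _ * _ * _ + _ * _ * _ * _); congr s; field.
Qed.

End Pfaffian.

(** * Real estimates *)

Section RealBounds.
Local Open Scope classical_set_scope.
Variables (R : realType) (r : R).
Hypotheses (r_gt0 : 0 < r) (r_lt1 : r < 1).
Let q := r ^+ 2.

Let q_gt0 : 0 < q. Proof. by rewrite exprn_gt0. Qed.
Let q_lt1 : q < 1. Proof. by rewrite expr_lt1 // ltW. Qed.
Let q1_gt0 : 0 < 1 - q. Proof. by rewrite subr_gt0. Qed.

Lemma factor_gt0 j : 0 < 1 - q ^+ j.+1.
Proof. by rewrite subr_gt0 exprn_ilt1 // ltW. Qed.

Lemma q_neq1 j : (0 < j)%N -> 1 - q ^+ j != 0.
Proof. by case: j => // j _; rewrite gt_eqF ?factor_gt0. Qed.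

Lemma geometric_le n : \sum_(0 <= m < n) q ^+ m <= (1 - q)^-1.
Proof.
rewrite -(ler_pM2l q1_gt0) divff ?gt_eqF // big_mkord.
have := subrX1 q n; rewrite -[1 - q]opprB mulNr => <-.
by rewrite opprB gerBl exprn_ge0 // ltW.
Qed.

Lemma qfact_gt0 j : 0 < qfact r j.
Proof. by apply: prodr_gt0 => i _; apply: factor_gt0. Qed.

Lemma qfact_noninc : nonincreasing_seq (qfact r).
Proof.
apply/nonincreasing_seqP => n; rewrite /qfact big_nat_recr //=.
by rewrite ger_pMr ?qfact_gt0 // gerBl exprn_ge0 // ltW.
Qed.

Lemma qfact_le1 j : qfact r j <= 1.
Proof. by have := qfact_noninc (leq0n j); rewrite {2}/qfact big_nil. Qed.

(** With t = q^(i+1), 1 / (1 - t) = 1 + t / (1 - t) <= exp (q^i / (1 - q)), and these exponents sum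
    to at most (1 - q)^-2. Positivity of this bound makes the q-binomials uniformly bounded. *)
Definition qfact_lb : R := expR (- ((1 - q)^-1 * (1 - q)^-1)).

Lemma qfact_ge j : qfact_lb <= qfact r j.
Proof.
have H : expR (- \sum_(0 <= i < j) q ^+ i / (1 - q)) <= qfact r j.
  rewrite -sumrN expR_sum /qfact; apply: ler_prod => i _; rewrite expR_ge0 /=.
  have f0 := factor_gt0 i.
  rewrite expRN -[leRHS]invrK lef_pV2 ?posrE ?expR_gt0 ?invr_gt0 //.
  apply: le_trans (expR_ge1Dx _); rewrite -subr_ge0.
  have -> : 1 + q ^+ i / (1 - q) - (1 - q ^+ i.+1)^-1 =
    q ^+ i * (1 - q) ^-1 - q^+ i.+1 / (1 - q ^+ i.+1).
    by field; rewrite !gt_eqF.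
  rewrite subr_ge0; apply: ler_pM.
  - by rewrite exprn_ge0 // ltW.
  - by rewrite invr_ge0 ltW.
  - by rewrite exprS ler_piMl ?exprn_ge0 // ltW.
  - by rewrite lef_pV2 ?posrE // lerB // exprS ler_piMr ?exprn_ile1 // ltW.
apply: le_trans H; rewrite ler_expR lerN2 -mulr_suml ler_wpM2r //.
  by rewrite invr_ge0 ltW.
exact: geometric_le.
Qed.

Lemma qfact_cvg : exists2 L : R, 0 < L & qfact r @ \oo --> L.
Proof.
exists (limn (qfact r)).
  apply: lt_le_trans (expR_gt0 _) _.
  apply: limr_ge; last by near=> n; apply: qfact_ge.
  apply: nonincreasing_is_cvgn; first exact: qfact_noninc.
  by exists 0 => _ [n _ <-]; apply/ltW/qfact_gt0.
apply: nonincreasing_is_cvgn; first exact: qfact_noninc.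
by exists 0 => _ [n _ <-]; apply/ltW/qfact_gt0.
Unshelve. all: by end_near. Qed.

Lemma qfactV_ge0 k : 0 <= qfactV r k.
Proof. by case: k => [j|j] //=; rewrite invr_ge0 ltW ?qfact_gt0. Qed.

Lemma qfactV_le k : qfactV r k <= qfact_lb^-1.
Proof.
case: k => [j|j] /=; last by rewrite invr_ge0 expR_ge0.
by rewrite lef_pV2 ?posrE ?qfact_gt0 ?expR_gt0 // qfact_ge.
Qed.

Lemma qcoef_ge0 n k : 0 <= qcoef r n k.
Proof. by rewrite /qcoef !mulr_ge0 ?qfactV_ge0 // ltW ?qfact_gt0. Qed.

Lemma qcoef_le n k : qcoef r n k <= qfact_lb^-1 * qfact_lb^-1.
Proof.
rewrite /qcoef -[leRHS]mul1r mulrA ler_pM ?mulr_ge0 ?qfactV_ge0 ?qfactV_le //.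
  by rewrite ltW ?qfact_gt0.
by rewrite ler_pM ?qfactV_ge0 ?qfactV_le ?qfact_le1 // ltW ?qfact_gt0.
Qed.

(** Factor by factor, 1 - q^(b+1) <= 1 - q^(a+b+1). *)
Lemma qfact_add a b : qfact r a * qfact r b <= qfact r (a + b).
Proof.
elim: b => [|b IH]; first by rewrite addn0 {2}/qfact big_nil mulr1.
rewrite addnS /qfact !big_nat_recr //= -!/(qfact r _) mulrA.
apply: ler_pM IH _; rewrite ?mulr_ge0 ?(ltW (qfact_gt0 _)) ?(ltW (factor_gt0 _)) //.
by rewrite lerB // -addnS exprD ler_piMl ?exprn_ge0 ?exprn_ile1 // ltW.
Qed.

Lemma qcoef_ge1 n k : (`|k| <= n)%N -> 1 <= qcoef r n k.
Proof.
move=> kn; rewrite /qcoef.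
have [a [b [-> -> ab]]] : exists a b : nat,
    [/\ n%:Z + k = a, n%:Z - k = b & n.*2 = (a + b)%N].
  by exists (absz (n%:Z + k)), (absz (n%:Z - k)); split; lia.
rewrite /= ab -mulrA -invfM ler_pdivlMr ?mulr_gt0 ?qfact_gt0 // mul1r.
exact: qfact_add.
Qed.

Lemma qfactV_cvg (L : R) (k : int) : 0 < L -> qfact r @ \oo --> L ->
  (fun n : nat => qfactV r (n%:Z + k)) @ \oo --> L^-1.
Proof.
move=> L0 cL; have cV : (fun n => (qfact r n)^-1) @ \oo --> L^-1.
  by apply: cvgV; rewrite ?gt_eqF.
case: k => j.
  rewrite (_ : (fun _ => _) = (fun n => (qfact r (n + j)%N)^-1)) //.
  by rewrite (cvg_shiftn j (fun n => (qfact r n)^-1)).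
rewrite -(cvg_shiftn j.+1); apply: cvg_trans cV; apply: near_eq_cvg.
near=> n; have E : (n + j.+1)%N%:Z + Negz j = n%:Z by lia.
by transitivity (qfactV r ((n + j.+1)%N%:Z + Negz j)); rewrite // E.
Unshelve. all: by end_near. Qed.

(** All three q-factorials tend to L, so the limit is L / L^2 whatever k is. This is why theta is a
    constant multiple of the series. *)
Lemma qcoef_cvg (L : R) (k : int) : 0 < L -> qfact r @ \oo --> L ->
  (fun n : nat => qcoef r n k) @ \oo --> L^-1.
Proof.
move=> L0 cL; rewrite -[L^-1]mul1r -(divff (lt0r_neq0 L0)).
apply: cvgM; last by apply: qfactV_cvg.
apply: cvgM; last by apply: qfactV_cvg.
rewrite (_ : (fun n : nat => qfact r n.*2) = qfact r \o (fun n => 2 * n)%N).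
  by apply: cvg_comp cL; apply: cvg_mulnl.
by apply/funext => n /=; rewrite mul2n.
Qed.

Lemma jtermN_ge0 rho k : 0 < rho -> 0 <= jterm r (- rho) k.
Proof.
move=> rho0; rewrite jtermN ?lt0r_neq0 //.
by rewrite mulr_ge0 // exprz_ge0 // ltW.
Qed.

(* The q-binomials are at least 1, so the sum is at most the finite product at
   - rho, whose factors are all positive. *)
Lemma gsum_bounded rho : 0 < rho ->
  exists B : R, forall N, \sum_(k <- box N) jterm r (- rho) k <= B.
Proof.
(* The bound comes from 1 + t <= exp t on each factor and from the geometric series in the
   exponents. *)
move=> rho0; exists (expR (rho * (1 - q)^-1 + q / rho * (1 - q)^-1)) => N.
apply: (@le_trans _ _ (theta_part r (- rho) N)).
  have z0 : - rho != 0 by rewrite oppr_eq0 lt0r_neq0.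
  rewrite (theta_part_sum (lt0r_neq0 r_gt0) q_neq1 z0 (leqnn N)).
  rewrite big_seq [leRHS]big_seq; apply: ler_sum => k; rewrite mem_box => kN.
  by rewrite ler_peMl ?jtermN_ge0 ?qcoef_ge1.
have H : theta_part r (- rho) N <=
    expR (\sum_(0 <= m < N) (rho * q ^+ m + q / rho * q ^+ m)).
  rewrite expR_sum; apply: ler_prod => m _.
  rewrite mulrN opprK invrN mulrN opprK expRD.
  have h1 : 0 <= q ^+ m * rho by rewrite mulr_ge0 ?exprn_ge0 // ltW.
  have h2 : 0 <= q ^+ m.+1 / rho by rewrite mulr_ge0 ?exprn_ge0 ?invr_ge0 // ltW.
  rewrite mulr_ge0 ?addr_ge0 //=; apply: ler_pM; rewrite ?addr_ge0 //.
    by rewrite mulrC; apply: expR_ge1Dx.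
  by rewrite (_ : q / rho * _ = q ^+ m.+1 / rho) ?expR_ge1Dx // exprS; ring.
apply: le_trans H _; rewrite ler_expR big_split /= -!mulr_sumr.
rewrite lerD // ler_wpM2l ?geometric_le ?mulr_ge0 ?invr_ge0 // ltW //.
Qed.

End RealBounds.

(** * Dominated convergence for sums over growing boxes *)

Section Tannery.
Local Open Scope classical_set_scope.

Lemma cvg_sum_seq (R : realType) (I : Type) (s : seq I) (f : nat -> I -> R)
    (l : I -> R) :
  (forall i, f ^~ i @ \oo --> l i) ->
  (fun n => \sum_(i <- s) f n i) @ \oo --> \sum_(i <- s) l i.
Proof.
move=> fl; elim: s => [|i s IH].
  by rewrite big_nil; under eq_fun do rewrite big_nil; apply: cvg_cst.
by rewrite big_cons; under eq_fun do rewrite big_cons; apply: cvgD.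
Qed.

Lemma box_sum_nondecr (R : realType) (g : int -> R) : (forall k, 0 <= g k) ->
  nondecreasing_seq (fun N => \sum_(k <- box N) g k).
Proof.
move=> g0 n N nN; rewrite (big_sub_uniq g (uniq_box n) (uniq_box N)).
  by rewrite lerDl sumr_ge0.
by move=> k; rewrite !mem_box => /leq_trans; apply.
Qed.

Lemma box_sum_cvg (R : realType) (g : int -> R) B : (forall k, 0 <= g k) ->
  (forall N, \sum_(k <- box N) g k <= B) -> cvgn (fun N => \sum_(k <- box N) g k).
Proof.
move=> g0 gB; apply: nondecreasing_is_cvgn; first exact: box_sum_nondecr.
by exists B => _ [n _ <-].
Qed.

(** Outside a large fixed box the mass of [g] is small uniformly in n, and inside it finitely many
    coefficients tend to 0. *)
Lemma tannery (R : realType) (a : nat -> int -> R) (g : int -> R) (A B : R) :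
  (forall n k, 0 <= a n k <= A) -> (forall k, a ^~ k @ \oo --> 0) ->
  (forall k, 0 <= g k) -> (forall N, \sum_(k <- box N) g k <= B) ->
  (fun n => \sum_(k <- box n) a n k * g k) @ \oo --> 0.
Proof.
move=> aA a0 g0 gB; have cG := box_sum_cvg g0 gB.
have A0 : 0 <= A by have /andP[] := aA 0 0; apply: le_trans.
set G := fun N => _ in cG; set L := limn G.
have GL N : G N <= L by apply: nondecreasing_cvgn_le => //; apply: box_sum_nondecr.
have sum0 K : (fun n => \sum_(k <- box K) a n k * g k) @ \oo --> 0.
  have := @cvg_sum_seq _ _ (box K) (fun n k => a n k * g k) (fun=> 0).
  rewrite big1_eq; apply => k; rewrite -(mul0r (g k)).
  by apply: cvgM; [apply: a0|apply: cvg_cst].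
apply/cvgr0Pnorm_lt => e e0.
(* The divisor is A + 1 because A may be 0. *)
have d0 : 0 < e / 2 / (A + 1) by rewrite !divr_gt0 // ltr_wpDl.
have [K _ KG] : \forall K \near \oo, `|L - G K| < e / 2 / (A + 1).
  by move/cvgrPdist_lt: cG; apply.
have {KG} := KG K (leqnn K); rewrite ger0_norm ?subr_ge0 // => KG.
have /cvgr0Pnorm_lt/(_ (e / 2)) := sum0 K; rewrite divr_gt0 // => /(_ isT) H.
near=> n.
have Kn : (K <= n)%N by near: n; exists K.
have ag0 m k : 0 <= a m k * g k by have /andP[? _] := aA m k; rewrite mulr_ge0.
have SK : \sum_(k <- box K) a n k * g k < e / 2.
  have : `|\sum_(k <- box K) a n k * g k| < e / 2 by near: n; exact: H.
  by rewrite ger0_norm // sumr_ge0.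
have sKn : {subset box K <= box n}.
  by move=> k; rewrite !mem_box => /leq_trans; apply.
rewrite ger0_norm ?sumr_ge0 //.
rewrite (big_sub_uniq _ (uniq_box K) (uniq_box n) sKn) [e in _ < e]splitr ltrD //.
have tail : \sum_(k <- box n | k \notin box K) g k < e / 2 / (A + 1).
  apply: le_lt_trans KG; rewrite lerBrDl; apply: le_trans (GL n).
  by rewrite /G [leRHS](big_sub_uniq _ (uniq_box K) (uniq_box n) sKn).
apply: (@le_lt_trans _ _ (A * \sum_(k <- box n | k \notin box K) g k)).
  rewrite mulr_sumr; apply: ler_sum => k _; rewrite ler_wpM2r //.
  by have /andP[] := aA n k.
rewrite ltr_pdivlMr ?ltr_wpDl // in tail; apply: le_lt_trans tail.
by rewrite mulrDr mulr1 mulrC lerDl sumr_ge0.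
Unshelve. all: by end_near. Qed.

End Tannery.

(** * The theta function as a series *)

Section ComplexLimits.
Local Open Scope classical_set_scope.
Variable R : realType.
Implicit Types (u v : nat -> R[i]^o) (z : R[i]).

Local Notation Re := (@complex.Re R).
Local Notation Im := (@complex.Im R).

(** The norm of R[i] takes its values in R[i], whereas the estimates and monotone limits live in
    R. *)
Definition modulus z : R := Re `|z|.

Lemma modulusE z : (modulus z)%:C = `|z|.
Proof. by rewrite /modulus RRe_real ?normr_real. Qed.

Lemma modulus_ge0 z : 0 <= modulus z.
Proof. by rewrite -ler0c modulusE normr_ge0. Qed.

Lemma modulus_real (a : R) : modulus a%:C = `|a|.
Proof. by rewrite /modulus normc_def /= expr0n addr0 sqrtr_sqr. Qed.

Lemma modulusM z1 z2 : modulus (z1 * z2) = modulus z1 * modulus z2.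
Proof. by apply: complexI; rewrite rmorphM !modulusE normrM. Qed.

Lemma modulus_eq0 z : (modulus z == 0) = (z == 0).
Proof. by rewrite -(inj_eq (@complexI R)) modulusE; apply: normr_eq0. Qed.

Lemma modulusXz z (k : int) : modulus (z ^ k) = modulus z ^ k.
Proof.
apply: complexI; transitivity ((modulus z)%:C ^ k); last by rewrite fmorphXz.
rewrite !modulusE; case: k => n; first by rewrite -!exprnP normrX.
by rewrite /= normfV normrX.
Qed.

Lemma modulus_sum (I : Type) (s : seq I) (P : pred I) (f : I -> R[i]) :
  modulus (\sum_(i <- s | P i) f i) <= \sum_(i <- s | P i) modulus (f i).
Proof.
rewrite -lecR modulusE rmorph_sum.
by rewrite [leRHS](eq_bigr (fun i => `|f i|)) ?ler_norm_sum.
Qed.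

Lemma cvgC_modulus u (l : R[i]^o) :
  (fun n => modulus (u n - l)) @ \oo --> (0 : R) -> u @ \oo --> l.
Proof.
move=> /cvgr0Pnorm_lt ul; apply/cvgrPdist_lt => e e0.
have eE : e = (Re e)%:C by rewrite RRe_real ?gtr0_real.
have /ul : 0 < Re e by rewrite -ltcR -eE.
apply: filterS => n; rewrite ger0_norm ?modulus_ge0 // => H.
by rewrite distrC eE -modulusE ltcR.
Qed.

Lemma cvgC_real (x : nat -> R) (l : R) : x @ \oo --> l ->
  (fun n => (x n)%:C : R[i]^o) @ \oo --> (l%:C : R[i]^o).
Proof.
move=> xl; apply: cvgC_modulus; apply/cvgr0Pnorm_lt => e e0.
move/cvgrPdist_lt: xl => /(_ e e0); apply: filterS => n.
by rewrite -rmorphB modulus_real normr_id distrC.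
Qed.

Lemma modulus_Re z : `|Re z| <= modulus z.
Proof. by rewrite -lecR modulusE normc_ge_Re. Qed.

Lemma modulus_Im z : `|Im z| <= modulus z.
Proof.
rewrite -[Im z]opprK -ReiNIm normrN; apply: le_trans (modulus_Re _) _.
rewrite modulusM (_ : modulus 'i = 1) ?mulr1 //.
by rewrite /modulus normc_def /= expr0n expr1n add0r sqrtr1.
Qed.

(* x + G is nondecreasing and bounded. *)
Lemma cvg_dominated_real (x : nat -> R) (G : nat -> R) (B : R) :
  (forall n, `|x n.+1 - x n| <= G n.+1 - G n) -> (forall n, G n <= B) -> cvgn x.
Proof.
move=> xG GB.
have Gnd n : G n <= G n.+1 by rewrite -subr_ge0; apply: le_trans (xG n).
have Gmono : nondecreasing_seq G by apply/nondecreasing_seqP.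
have cG : cvgn G.
  by apply: nondecreasing_is_cvgn => //; exists B => _ [n _ <-].
have dom n : `|x n - x 0%N| <= G n - G 0%N.
  elim: n => [|n IH]; first by rewrite !subrr normr0.
  rewrite (_ : x n.+1 - _ = (x n.+1 - x n) + (x n - x 0%N)); last by ring.
  apply: le_trans (ler_normD _ _) _.
  by rewrite (_ : G n.+1 - _ = (G n.+1 - G n) + (G n - G 0%N)) ?lerD //; ring.
have cxG : cvgn (fun n => x n + G n).
  apply: nondecreasing_is_cvgn.
    apply/nondecreasing_seqP => n; have := xG n; rewrite ler_norml => /andP[+ _]; lra.
  exists (x 0%N + (B - G 0%N) + B) => _ [n _ <-].
  rewrite lerD // -lerBlDl; apply: le_trans (ler_norm _) _.
  by apply: le_trans (dom n) _; rewrite lerD2r.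
rewrite (_ : x = (fun n => (x n + G n) - G n)).
  exact: is_cvgB.
by apply/funext => n; rewrite addrK.
Qed.

Lemma cvg_dominated u (G : nat -> R) (B : R) :
  (forall n, modulus (u n.+1 - u n) <= G n.+1 - G n) -> (forall n, G n <= B) ->
  cvgn u.
Proof.
move=> uG GB.
have cRe : cvgn (fun n => Re (u n)).
  apply: (cvg_dominated_real _ GB) => n; apply: le_trans (uG n).
  by rewrite -raddfB; apply: modulus_Re.
have cIm : cvgn (fun n => Im (u n)).
  apply: (cvg_dominated_real _ GB) => n; apply: le_trans (uG n).
  by rewrite -raddfB; apply: modulus_Im.
rewrite (_ : u = (fun n => (Re (u n))%:C + 'i * (Im (u n))%:C)); last first.
  by apply/funext => n; rewrite -complexE.
apply/cvg_ex.
exists ((limn (fun n => Re (u n)))%:C + 'i * (limn (fun n => Im (u n)))%:C).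
apply: cvgD; first exact: cvgC_real.
by apply: cvgM; [apply: cvg_cst|apply: cvgC_real].
Qed.

End ComplexLimits.

Section ThetaSeries.
Local Open Scope classical_set_scope.
Variables (R : realType) (r : R).
Hypotheses (r_gt0 : 0 < r) (r_lt1 : r < 1).
Implicit Types (x z : R[i]).
Local Notation rC := (r%:C).
Local Notation jsum z N := (\sum_(k <- box N) jterm rC z k).

Let rC0 : rC != 0. Proof. by rewrite fmorph_eq0 lt0r_neq0. Qed.

Lemma qC_neq1 j : (0 < j)%N -> 1 - (rC ^+ 2) ^+ j != 0.
Proof.
move=> j0; rewrite -!rmorphXn -(rmorph1 (real_complex R)) -rmorphB fmorph_eq0.
exact: q_neq1.
Qed.

Lemma modulus_jterm z k : z != 0 -> modulus (jterm rC z k) = jterm r (- modulus z) k.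
Proof.
move=> z0; rewrite jtermN ?modulus_eq0 // /jterm !modulusM !modulusXz.
rewrite (_ : modulus (-1) = 1) ?exp1rz ?mul1r; last first.
  by apply: complexI; rewrite modulusE normrN1.
rewrite (_ : modulus rC = r) //; apply: complexI.
by rewrite modulusE ger0_norm // ler0c ltW.
Qed.

Lemma qcoef_complex n k : qcoef rC n k = (qcoef r n k)%:C.
Proof.
have fE j : qfact rC j = (qfact r j)%:C.
  rewrite /qfact rmorph_prod; apply: eq_bigr => i _.
  by rewrite rmorphB rmorph1 !rmorphXn.
have VE l : qfactV rC l = (qfactV r l)%:C.
  by case: l => [j|j] /=; rewrite ?rmorph0 // fE -fmorphV.
by rewrite /qcoef fE !VE -!rmorphM.
Qed.

Lemma gsum_modulus_bounded z : z != 0 ->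
  exists B : R, forall N, \sum_(k <- box N) jterm r (- modulus z) k <= B.
Proof.
by move=> z0; apply: gsum_bounded; rewrite // lt0r modulus_eq0 z0 modulus_ge0.
Qed.

Lemma jterm_modulus_ge0 z k : z != 0 -> 0 <= jterm r (- modulus z) k.
Proof. by move=> z0; rewrite jtermN_ge0 // lt0r modulus_eq0 z0 modulus_ge0. Qed.

Lemma jsum_cvg z : z != 0 -> cvgn (fun N => jsum z N : R[i]^o).
Proof.
move=> z0; have [B gB] := gsum_modulus_bounded z0.
apply: (cvg_dominated _ gB) => n.
have sub : {subset box n <= box n.+1}.
  by move=> k; rewrite !mem_box => /leq_trans; apply.
rewrite !(big_sub_uniq _ (uniq_box n) (uniq_box n.+1) sub).
rewrite [X in modulus X]addrAC subrr add0r [leRHS]addrAC subrr add0r.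
apply: le_trans (modulus_sum _ _ _) _.
by apply: ler_sum => k _; rewrite modulus_jterm.
Qed.

Definition jlim z : R[i]^o := limn (fun N => jsum z N : R[i]^o).

(** The Jacobi triple product with Lam = 1 / (q; q)_oo, q = r^2. Only its independence of z matters,
    because it ends up as a scale factor of a minor. *)
Lemma theta_part_cvg : exists Lam : R, forall z, z != 0 ->
  (theta_part rC z : nat -> R[i]^o) @ \oo --> (Lam%:C * jlim z : R[i]^o).
Proof.
have [L L0 qL] := qfact_cvg r_gt0 r_lt1; exists L^-1 => z z0.
have [B gB] := gsum_modulus_bounded z0.
have c1 : (fun n => L^-1%:C * jsum z n : R[i]^o) @ \oo --> (L^-1%:C * jlim z : R[i]^o).
  by apply: cvgM; [apply: cvg_cst|apply: jsum_cvg].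
suff c2 : (fun n => theta_part rC z n - L^-1%:C * jsum z n : R[i]^o) @ \oo
    --> (0 : R[i]^o).
  exact: cvg_sub0 c2 c1.
apply: cvgC_modulus.
have dist0 k : (fun n => `|qcoef r n k - L^-1|) @ \oo --> (0 : R).
  apply/cvgr0Pnorm_lt => e e0; have := qcoef_cvg r_gt0 r_lt1 k L0 qL.
  by move/cvgrPdist_lt => /(_ e e0); apply: filterS => n; rewrite normr_id distrC.
have t0 : (fun n => \sum_(k <- box n)
    `|qcoef r n k - L^-1| * jterm r (- modulus z) k) @ \oo --> (0 : R).
  apply: (@tannery _ _ _ ((qfact_lb r)^-1 * (qfact_lb r)^-1 + L^-1) B) => // [n k|k].
  - rewrite normr_ge0 /=; apply: le_trans (ler_normB _ _) _.
    have L1 : 0 <= L^-1 by rewrite invr_ge0 ltW.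
    by rewrite (ger0_norm L1) ger0_norm ?qcoef_ge0 // lerD2r qcoef_le.
  - exact: jterm_modulus_ge0.
apply: squeeze_cvgr (cvg_cst 0) t0.
near=> n; rewrite modulus_ge0 /= subr0.
rewrite (theta_part_sum rC0 qC_neq1 z0 (leqnn n)) mulr_sumr -sumrB.
apply: le_trans (modulus_sum _ _ _) _; apply: ler_sum => k _.
have -> : qcoef rC n k * jterm rC z k - L^-1%:C * jterm rC z k =
    (qcoef r n k - L^-1)%:C * jterm rC z k.
  by rewrite qcoef_complex rmorphB mulrBl.
by rewrite modulusM modulus_jterm // modulus_real.
Unshelve. all: by end_near. Qed.

End ThetaSeries.

(** * Rank two in the limit *)

Section LatticeLimit.
Local Open Scope classical_set_scope.
Variables (R : realType) (r : R).
Hypotheses (r_gt0 : 0 < r) (r_lt1 : r < 1).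
Implicit Types (x z : R[i]).
Local Notation rC := (r%:C).
Local Notation jsum z N := (\sum_(k <- box N) jterm rC z k).

Lemma rC_neq0 : rC != 0. Proof. by rewrite fmorph_eq0 lt0r_neq0. Qed.

(* The index set of [lattice_sum] lies between two square boxes, so its distance
   to the product of partial sums is at most the mass between the boxes. *)
Lemma lattice_sum_cvg x z : x != 0 -> z != 0 ->
  (fun N => lattice_sum rC N x z : R[i]^o) @ \oo -->
  (jlim r (x * z) * jlim r (x / z) : R[i]^o).
Proof.
move=> x0 z0; have xz0 : x * z != 0 by rewrite mulf_neq0.
have xVz0 : x / z != 0 by rewrite mulf_neq0 ?invr_eq0.
have [B1 gB1] := gsum_modulus_bounded r_gt0 r_lt1 xz0.
have [B2 gB2] := gsum_modulus_bounded r_gt0 r_lt1 xVz0.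
have g1 k := jterm_modulus_ge0 r_gt0 k xz0.
have g2 k := jterm_modulus_ge0 r_gt0 k xVz0.
have cG1 := box_sum_cvg g1 gB1.
have cG2 := box_sum_cvg g2 gB2.
set G1 := fun N => _ in cG1; set G2 := fun N => _ in cG2.
have c1 : (fun N => jsum (x * z) N * jsum (x / z) N : R[i]^o) @ \oo -->
    (jlim r (x * z) * jlim r (x / z) : R[i]^o).
  by apply: cvgM; apply: jsum_cvg.
suff c2 : (fun N => lattice_sum rC N x z - jsum (x * z) N * jsum (x / z) N : R[i]^o)
    @ \oo --> (0 : R[i]^o) by exact: cvg_sub0 c2 c1.
apply: cvgC_modulus.
pose h (ml : int * int) :=
  jterm r (- modulus (x * z)) ml.1 * jterm r (- modulus (x / z)) ml.2.
have h0 ml : 0 <= h ml by rewrite mulr_ge0.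
have hbox N : \sum_(ml <- lattice_box N) h ml = G1 N * G2 N.
  rewrite big_allpairs_dep /G1 /G2 mulr_suml; apply: eq_bigr => a _.
  by rewrite mulr_sumr.
have d0 : (fun N => G1 N.*2.+1 * G2 N.*2.+1 - G1 N * G2 N) @ \oo --> (0 : R).
  have c : (fun N => G1 N * G2 N) @ \oo --> limn G1 * limn G2 by apply: cvgM.
  have sh : (fun N : nat => N.*2.+1) @ \oo --> \oo.
    rewrite (_ : (fun _ => _) = (fun N => N + 1)%N \o (fun N => 2 * N)%N); last first.
      by apply/funext => N /=; rewrite mul2n addn1.
    by apply: cvg_comp; [apply: cvg_mulnl|apply: cvg_addnr].
  rewrite -(subrr (limn G1 * limn G2)); apply: cvgB => //.
  exact: (cvg_comp _ _ sh c).
apply: squeeze_cvgr (cvg_cst 0) d0; near=> N; rewrite modulus_ge0 /= subr0.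
have split_lattice (K : nmodType) (f : int * int -> K) :=
  big_sub_uniq f (uniq_lattice_box N) (uniq_lattice N) (@lattice_box_sub N).
rewrite /lattice_sum split_lattice.
have -> : \sum_(ml <- lattice_box N) jterm rC (x * z) ml.1 * jterm rC (x / z) ml.2
   = jsum (x * z) N * jsum (x / z) N.
  rewrite big_allpairs_dep mulr_suml; apply: eq_bigr => a _.
  by rewrite mulr_sumr.
rewrite addrAC subrr add0r; apply: le_trans (modulus_sum _ _ _) _.
rewrite (eq_bigr h) => [|ml _]; last by rewrite modulusM !modulus_jterm.
rewrite -!hbox lerBrDl -split_lattice.
rewrite [leRHS](big_sub_uniq h (uniq_lattice N) (uniq_lattice_box _)
  (@sub_lattice_box N)).
by rewrite lerDl sumr_ge0.
Unshelve. all: by end_near. Qed.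

(** A minor is polynomial in its entries, hence the limit of the minors of [lattice_sum], all zero
    by the rank. *)
Lemma minor3_jlim x1 x2 x3 z1 z2 z3 :
  x1 != 0 -> x2 != 0 -> x3 != 0 -> z1 != 0 -> z2 != 0 -> z3 != 0 ->
  minor3 (fun x z => jlim r (x * z) * jlim r (x / z)) x1 x2 x3 z1 z2 z3 = 0.
Proof.
move=> x10 x20 x30 z10 z20 z30.
have c : (fun N => minor3 (lattice_sum rC N) x1 x2 x3 z1 z2 z3 : R[i]^o) @ \oo -->
    (minor3 (fun x z => jlim r (x * z) * jlim r (x / z)) x1 x2 x3 z1 z2 z3 : R[i]^o).
  by rewrite /minor3; apply: cvgD; [apply: cvgB|]; apply: cvgM;
    try (exact: lattice_sum_cvg); apply: cvgB; apply: cvgM; exact: lattice_sum_cvg.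
have c0 : (fun N => minor3 (lattice_sum rC N) x1 x2 x3 z1 z2 z3 : R[i]^o) @ \oo
    --> (0 : R[i]^o).
  rewrite (_ : (fun _ => _) = cst 0); first exact: cvg_cst.
  apply/funext => N; have E := lattice_sumE rC_neq0 N.
  rewrite /minor3 !E //.
  exact: (minor3_rank2
    (fun x => \sum_(a <- box N) rC ^ (2 * a * a - 2 * a) * x ^ (2 * a))
    (fun z => \sum_(b <- box N) rC ^ (2 * b * b) * z ^ (2 * b))
    (fun x => \sum_(a <- box N) rC ^ (2 * a * a) * x ^ (2 * a + 1))
    (fun z => \sum_(b <- box N) - rC ^ (2 * b * b + 2 * b) * z ^ (2 * b + 1))).
exact: (cvg_unique _ c c0).
Qed.

End LatticeLimit.

(** * The odd theta function *)

(** Here e is an exponential prefactor and the k's are the gauge factors that turn theta into s, so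
    only exponents need comparing. The equality survives c = 0 or d = 0, so A and B are rewritten
    without regularity. *)
Lemma ratio_regauge (K : fieldType) (a b c d e k1 k2 k3 k4 : K) :
  e * k3 * k4 = k1 * k2 -> k3 != 0 -> k4 != 0 ->
  a * b / (c * d) * e = k1 * a * (k2 * b) / (k3 * c * (k4 * d)).
Proof.
move=> E k30 k40; rewrite (mulrACA k1) -E (mulrACA k3) [(_ * (c * d))^-1]invfM.
by move: (a * b) ((c * d)^-1) => m w; field; rewrite k30 k40.
Qed.

Lemma ratio_regauge1 (K : fieldType) (a d e k1 k2 k3 : K) :
  e * k3 = k1 * k2 -> k3 != 0 -> e * (a / d) = k1 * (k2 * a / (k3 * d)).
Proof.
move=> E k30; have -> : e = k1 * k2 / k3 by rewrite -E mulfK.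
by rewrite [(k3 * d)^-1]invfM; move: d^-1 => w; field.
Qed.

Section Cpow.
Variables (R : realType) (p : R).
Implicit Types a b : R[i].

Lemma cexpD a b : cexp (a + b) = cexp a * cexp b.
Proof.
case: a b => [a1 a2] [b1 b2]; rewrite /cexp /= expRD cosD sinD.
by apply/eqP; rewrite eq_complex /=; apply/andP; split; apply/eqP; ring.
Qed.

Lemma cpowD a b : cpow p (a + b) = cpow p a * cpow p b.
Proof. by rewrite /cpow mulrDl cexpD. Qed.

Lemma cpow0 : cpow p 0 = 1.
Proof. by rewrite /cpow mul0r /cexp /= expR0 cos0 sin0 mul1r. Qed.

Lemma cpow_neq0 a : cpow p a != 0.
Proof.
apply/eqP => a0; have := cpowD a (- a).
by rewrite a0 mul0r subrr cpow0 => /eqP; rewrite oner_eq0.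
Qed.

Lemma cpowN a : cpow p (- a) = (cpow p a)^-1.
Proof.
apply: (mulfI (cpow_neq0 a)); rewrite divff ?cpow_neq0 //.
by rewrite -cpowD subrr cpow0.
Qed.

End Cpow.

Section Theta.
Local Open Scope classical_set_scope.
Variables (R : realType) (p : R).
Hypotheses (p_gt0 : 0 < p) (p_lt1 : p < 1).
Implicit Types (z : R[i]).
Let r := Num.sqrt p.
Let r_gt0 : 0 < r. Proof. by rewrite sqrtr_gt0. Qed.
Let r_lt1 : r < 1. Proof. by rewrite -sqrtr1 ltr_sqrt. Qed.
Let rE : r%:C ^+ 2 = p%:C.
Proof. by rewrite -rmorphXn sqr_sqrtr // ltW. Qed.

Let thetaE z : theta p z = limn (theta_part r%:C z : nat -> R[i]^o).
Proof. by rewrite /theta /theta_part rE. Qed.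

Lemma theta_cvg z : z != 0 ->
  (theta_part r%:C z : nat -> R[i]^o) @ \oo --> (theta p z : R[i]^o).
Proof.
move=> z0; rewrite thetaE; have [Lam H] := theta_part_cvg r_gt0 r_lt1.
by apply/cvg_ex; exists (Lam%:C * jlim r z); apply: H.
Qed.

Lemma theta_jlim : exists Lam : R, forall z, z != 0 -> theta p z = Lam%:C * jlim r z.
Proof.
have [Lam H] := theta_part_cvg r_gt0 r_lt1; exists Lam => z z0.
exact: (cvg_unique _ (theta_cvg z0) (H z z0)).
Qed.

Lemma theta1 : theta p 1 = 0.
Proof.
have c1 := theta_cvg (oner_neq0 _).
suff c0 : (theta_part r%:C 1 : nat -> R[i]^o) @ \oo --> (0 : R[i]^o).
  exact: (cvg_unique _ c1 c0).
rewrite -(cvg_shiftn 1) (_ : (fun _ => _) = cst 0); first exact: cvg_cst.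
apply/funext => n; rewrite addn1 /theta_part big_nat_recl // expr0 mul1r subrr.
by rewrite !mul0r.
Qed.

(** Inverting z shifts the two families of factors by one place against each other. The end factors
    are cross-multiplied, as 1 - p^n / z may vanish. *)
Lemma theta_part_inv z n : z != 0 ->
  theta_part r%:C z^-1 n * ((1 - z) * (1 - p%:C ^+ n / z)) =
  theta_part r%:C z n * ((1 - z^-1) * (1 - p%:C ^+ n * z)).
Proof.
move=> z0; elim: n => [|n IH]; first by rewrite /theta_part !big_nil expr0; ring.
rewrite /theta_part !big_nat_recr //= -!/(theta_part _ _ _) rE invrK.
transitivity (theta_part r%:C z^-1 n * ((1 - z) * (1 - p%:C ^+ n / z)) *
  ((1 - p%:C ^+ n.+1 * z) * (1 - p%:C ^+ n.+1 / z))); first by ring.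
by rewrite IH; ring.
Qed.

Lemma thetaV z : z != 0 -> theta p z^-1 = - (z^-1 * theta p z).
Proof.
(* The limit identity carries a factor 1 - z that is cancelled at the end, so z = 1 is set apart. *)
move=> z0; have [->|z1] := eqVneq z 1; first by rewrite invr1 theta1 mulr0 oppr0.
have pn : (fun n => p%:C ^+ n : R[i]^o) @ \oo --> (0 : R[i]^o).
  rewrite (_ : (fun _ => _) = (fun n => (p ^+ n)%:C)); last first.
    by apply/funext => n; rewrite rmorphXn.
  by apply: cvgC_real; apply: cvg_expr; rewrite ger0_norm // ltW.
have cst_ (c : R[i]) : (fun n : nat => c : R[i]^o) @ \oo --> (c : R[i]^o).
  exact: cvg_cst.
have zV0 : z^-1 != 0 by rewrite invr_eq0.
have c1 : (fun n => theta_part r%:C z^-1 n *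
    ((1 - z) * (1 - p%:C ^+ n / z)) : R[i]^o) @ \oo
    --> (theta p z^-1 * ((1 - z) * (1 - 0 / z)) : R[i]^o).
  apply: cvgM; first exact: theta_cvg.
  apply: cvgM; first exact: cst_.
  by apply: cvgB; [exact: cst_|apply: cvgM; [exact: pn|exact: cst_]].
have c2 : (fun n => theta_part r%:C z^-1 n *
    ((1 - z) * (1 - p%:C ^+ n / z)) : R[i]^o) @ \oo
    --> (theta p z * ((1 - z^-1) * (1 - 0 * z)) : R[i]^o).
  rewrite (_ : (fun n => _) = fun n =>
      theta_part r%:C z n * ((1 - z^-1) * (1 - p%:C ^+ n * z))).
    apply: cvgM; first exact: theta_cvg.
    apply: cvgM; first exact: cst_.
    by apply: cvgB; [exact: cst_|apply: cvgM; [exact: pn|exact: cst_]].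
  by apply/funext => n; apply: theta_part_inv.
have E : theta p z^-1 * ((1 - z) * (1 - 0 / z)) =
    theta p z * ((1 - z^-1) * (1 - 0 * z)).
  exact: (cvg_unique _ c1 c2).
rewrite !mul0r subr0 !mulr1 in E.
have z1' : 1 - z != 0 by rewrite subr_eq0 eq_sym.
by apply: (mulIf z1'); rewrite E; field.
Qed.

(** The part - u/2 of the exponent makes the function odd, given theta(1/z) = - theta(z)/z. The even
    part u^2/2 produces the bilinear exponents in A, B and c. *)
Definition sigma (u : R[i]) : R[i] := cpow p ((u * u - u) / 2) * theta p (cpow p u).

Lemma sigma_neq0 u : (sigma u != 0) = (theta p (cpow p u) != 0).
Proof. by rewrite /sigma mulf_eq0 negb_or cpow_neq0. Qed.

Lemma sigmaN u : sigma (- u) = - sigma u.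
Proof.
rewrite /sigma cpowN thetaV ?cpow_neq0 // mulrN mulrA -cpowN -cpowD.
by congr (- (cpow p _ * _)); field.
Qed.

(** The gauge exponents at x + z and x - z add up to (x^2 - x) + z^2, so the gauge only rescales
    rows and columns and preserves the rank. *)
Lemma sigma_minor3 x1 x2 x3 z1 z2 z3 :
  minor3 (fun x z => sigma (x + z) * sigma (x - z)) x1 x2 x3 z1 z2 z3 = 0.
Proof.
have [Lam H] := theta_jlim.
have E x z : sigma (x + z) * sigma (x - z) = (Lam%:C * Lam%:C * cpow p (x * x - x)) *
    cpow p (z * z) * (jlim r (cpow p x * cpow p z) * jlim r (cpow p x / cpow p z)).
  have e : cpow p (((x + z) * (x + z) - (x + z)) / 2) *
      cpow p (((x - z) * (x - z) - (x - z)) / 2) = cpow p (x * x - x) * cpow p (z * z).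
    by rewrite -!cpowD; congr cpow; field.
  rewrite /sigma !H ?cpow_neq0 // mulrACA e -cpowN -(cpowD _ x z) -(cpowD _ x (- z)).
  move: (jlim _ _) (jlim _ _) (cpow _ _) (cpow _ _) (Lam%:C) => /= j1 j2 k1 k2 L; ring.
pose f x z := jlim r (cpow p x * cpow p z) * jlim r (cpow p x / cpow p z).
transitivity (minor3 (fun x z => (Lam%:C * Lam%:C * cpow p (x * x - x)) *
  cpow p (z * z) * f x z) x1 x2 x3 z1 z2 z3); first by rewrite /minor3 !E.
rewrite (minor3_scale (fun x => Lam%:C * Lam%:C * cpow p (x * x - x))
  (fun z => cpow p (z * z)) f).
have -> : minor3 f x1 x2 x3 z1 z2 z3 = 0.
  exact: (minor3_jlim r_gt0 r_lt1 (cpow_neq0 p x1) (cpow_neq0 p x2) (cpow_neq0 p x3)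
    (cpow_neq0 p z1) (cpow_neq0 p z2) (cpow_neq0 p z3)).
by rewrite mulr0.
Qed.

Lemma sigma_three_term a b c d :
  sigma a * sigma b * sigma (c + d - a - b) * sigma (c - d)
  - sigma c * sigma (a + b - c) * sigma (d - b) * sigma (a - d)
  + sigma d * sigma (a + b - d) * sigma (c - b) * sigma (a - c) = 0.
Proof.
apply: three_term_of_minor3; rewrite ?pnatr_eq0 //.
- exact: sigmaN.
- exact: sigma_minor3.
Qed.

Variable kappa : R[i].
Let eta := 2 * kappa.

Lemma coefA_sigma u x : coefA p kappa u x = dynA sigma eta u x.
Proof.
rewrite /coefA /dynA /sigma -/eta.
have e : cpow p ((eta - u) * x) * cpow p ((u * u - u) / 2) *
    cpow p (((eta - x) * (eta - x) - (eta - x)) / 2) =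
    cpow p ((eta * eta - eta) / 2) * cpow p (((u - x) * (u - x) - (u - x)) / 2).
  by rewrite -!cpowD; congr cpow; field.
exact: ratio_regauge e (cpow_neq0 _ _) (cpow_neq0 _ _).
Qed.

Lemma coefB_sigma u x : Defs.coefB p kappa u x = dynB sigma eta u x.
Proof.
(* Oddness restores the arguments - x and - u with which theta occurs in B. *)
have -> : dynB sigma eta u x = sigma (eta - u) * sigma (- x) /
    (sigma (eta - x) * sigma (- u)).
  by rewrite !sigmaN /dynB mulrN mulrN invrN mulrNN [sigma u * _]mulrC.
rewrite /Defs.coefB /sigma -/eta.
have e : cpow p (eta * (x - u)) * cpow p (((eta - x) * (eta - x) - (eta - x)) / 2) *
    cpow p ((- u * - u - - u) / 2) =
    cpow p (((eta - u) * (eta - u) - (eta - u)) / 2) * cpow p ((- x * - x - - x) / 2).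
  by rewrite -!cpowD; congr cpow; field.
exact: ratio_regauge e (cpow_neq0 _ _) (cpow_neq0 _ _).
Qed.

Lemma coefc_sigma x : coefc p kappa x =
  cpow p ((eta - eta * eta) / 2) * (sigma (eta + x) / sigma x).
Proof.
rewrite /coefc /sigma -/eta.
have e : cpow p (eta * x) * cpow p ((x * x - x) / 2) = cpow p ((eta - eta * eta) / 2) *
    cpow p (((eta + x) * (eta + x) - (eta + x)) / 2).
  by rewrite -!cpowD; congr cpow; field.
exact: ratio_regauge1 e (cpow_neq0 _ _).
Qed.

(** For the odd letter the sign of the entry cancels against s(-x) = - s(x), and the constant factor
    of c drops out. For the even letters c(x) / c(x) is 1 because regularity excludes the zeros of
    c. *)
Lemma diag_sigma x phi (i : 'I_3) : regular p kappa x phi ->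
  (-1) ^+ parity i * (coefc p kappa x / coefc p kappa ((-1) ^+ parity i * x))
  = dynD sigma eta (i == ord_max) x.
Proof.
case=> -[t1 t2] c0 ex _; move: (c0 i); rewrite /parity /dynD.
have x0 : sigma x != 0 by rewrite sigma_neq0.
have ex0 : sigma (eta - x) != 0 by rewrite sigma_neq0.
case: (i == ord_max); rewrite ?expr1 ?expr0 ?mulN1r ?mul1r ?opprK => cx0.
  rewrite !coefc_sigma sigmaN; field.
  by rewrite ?oppr_eq0 ?cpow_neq0 ?x0 ?ex0.
by rewrite !divff.
Qed.

End Theta.

Theorem theorem2p3 (R : realType) (p : R) (kappa : R[i])
    (p_gt0 : 0 < p) (p_lt1 : p < 1) :
  let R12 (x : R[i]) (phi : 'rV[R[i]]_3) := op12 (Rop p kappa x phi) in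
  let R23 (x : R[i]) (phi : 'rV[R[i]]_3) := op23 (Rop p kappa x phi) in
  let h1 : 'I_3 := ord0 in
  let h3 : 'I_3 := ord_max in
  (forall (x y : R[i]) (phi : 'rV[R[i]]_3),
     (forall (z : R[i]) (j : 'I_3), z \in [:: x; y; x + y] ->
        regular p kappa z (phi + kappa *: weight R j) /\
        regular p kappa z (phi - kappa *: weight R j)) ->
     dyn_shift (R12 x) kappa h3 phi
       *m dyn_shift (R23 (x + y)) (- kappa) h1 phi
       *m dyn_shift (R12 y) kappa h3 phi
     = dyn_shift (R23 y) (- kappa) h1 phi
       *m dyn_shift (R12 (x + y)) kappa h3 phi
       *m dyn_shift (R23 x) (- kappa) h1 phi) /\
  (forall (x : R[i]) (phi : 'rV[R[i]]_3),
     regular p kappa x phi -> regular p kappa (- x) phi ->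
     Rop p kappa x phi *m Rop p kappa (- x) phi = 1%:M).
Proof.
have sN := sigmaN p_gt0 p_lt1.
have s3 := sigma_three_term p_gt0 p_lt1.
have cA := coefA_sigma p kappa.
have cB := coefB_sigma p_gt0 p_lt1 kappa.
have cD x phi i := @diag_sigma _ _ p_gt0 p_lt1 kappa x phi i.
have s0 := sigma_neq0 p.
split=> x *.
  exact: braid_relation sN s3 cA cB cD s0 _ _ _ _.
exact: unitarity_relation sN s3 cA cB cD s0 _ _ _ _.
Qed.
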